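(* Let $\beta=1$ and let $F$ be a Von Mises (VM) distribution with $x_F=\infty$. Suppose that (A) there exist $0<\gamma<\infty$ and $a_0<\infty$ such that $E Z^2(a)<a^\gamma$ for all $a>a_0$; and (B) there exists $a_0<\infty$ such that $f'(a)\le 0$ for all $a\ge a_0$. Then, for the better than average rule ($\beta=1$), $\overline{Y}_k-G^{-1}(\log k)$ converges almost surely to a finite random variable as $k\to\infty$.
   Context: Selection rule. $X_1,X_2,\ldots$ are i.i.d. with a common absolutely continuous distribution function $F$ such that $1-F(x)>0$ for all $x<\infty$; $X$ denotes a generic variable with distribution $F$. For fixed $\beta\ge1$, set $T_1=1$, $Y_1=X_1$, and inductively $T_{k+1}=\inf\{i>T_k: X_i>\beta\overline{Y}_k\}$, $Y_{k+1}=X_{T_{k+1}}$, where $\overline{Y}_k=\frac1k\sum_{j=1}^kY_j$. The case $\beta=1$ is the ''better than average rule''. Overshoot. $Z(a)$ denotes a random variable distributed as $X-a$ conditional on $X>a$, and $f(a)=E Z(a)=E(X-a\mid X>a)$. VM distribution. Let $x_F=\sup\{x:F(x)<1\}$. $F$, belonging to the domain of attraction of the Gumbel extreme value distribution $\exp\{-e^{-x}\}$, is a Von Mises function (VM) if there exist $x_0$ and $r>0$ such that for $x_0<x<x_F$, $1-F(x)=r\exp\{-\int_{x_0}^x[1/f_A(u)]\,du\}=:e^{-H(x)}$, where $f_A>0$ on $(x_0,x_F)$, $f_A$ is absolutely continuous on $(x_0,x_F)$ with derivative $f_A'$, and $\lim_{u\nearrow x_F}f_A'(u)=0$. Only VM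 distributions with $x_F=\infty$ are considered. The function $G$ is defined, with these $x_0$ and $r$, by $e^{-G(x)}=r\exp\{-\int_{x_0}^x[1/f(u)]\,du\}$ for $x>x_0$; it is strictly increasing, and $G^{-1}(\log k)$ is understood for all sufficiently large $k$. *)

(* Defs.v *)
From HB Require Import structures.
From mathcomp Require Import all_boot all_order all_algebra finmap.
From mathcomp Require Import all_classical all_reals all_analysis.

Set Implicit Arguments.
Unset Strict Implicit.
Unset Printing Implicit Defensive.

Import Order.TTheory GRing.Theory Num.Theory.
Import numFieldNormedType.Exports.

Local Open Scope classical_set_scope.
Local Open Scope ring_scope.

Definition mutually_independent (R : realType) (d : measure_display)
    (T : measurableType d) (P : probability T R) (I : choiceType)
    (X : I -> {RV P >-> R}) : Prop :=
  forall (J : {fset I}) (B : I -> set R),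
    (forall i, i \in J -> measurable (B i)) ->
    P (\bigcap_(i in [set` J]) (X i @^-1` B i)) =
    (\prod_(i <- J) P (X i @^-1` B i))%E.

(* A real-valued F forces all X i to have the same law. *)
Definition iid_with_df (R : realType) (d : measure_display)
    (T : measurableType d) (P : probability T R)
    (X : nat -> {RV P >-> R}) (F : R -> R) : Prop :=
  mutually_independent X /\ forall i x, cdf (X i) x = (F x)%:E.

Section selection_rule.
Context {R : realType}.
Implicit Types (beta : R) (x : nat -> R).

(* Observations, selection times and selected values are numbered from 0, so
   x i is the observation X_(i+1).  A time None stands for +oo, the infimum of
   the empty set. *)
Definition first_exceed x (t : nat) (c : R) : option nat :=
  if pselect (exists i, (t < i)%N && (c < x i)) is left ex
  then Some (ex_minn ex) else None.

(* An infinite time selects the value 0. *)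
Definition value_at x (t : option nat) : R := oapp x 0 t.

(* The pair (time of the selection number k.+1, sum of the first k.+1 selected
   values). *)
Fixpoint selection beta x (k : nat) : option nat * R :=
  if k is k'.+1 then
    let: (t, s) := selection beta x k' in
    let t' := obind (fun i => first_exceed x i (beta * (s / k%:R))) t in
    (t', s + value_at x t')
  else (Some 0%N, x 0%N).

Definition sel_time beta x (k : nat) : option nat := (selection beta x k).1.

Definition sel_value beta x (k : nat) : R := value_at x (sel_time beta x k).

Definition sel_mean beta x (k : nat) : R :=
  k%:R^-1 * \sum_(j < k) sel_value beta x j.

Lemma selection_sum beta x k :
  (selection beta x k).2 = \sum_(j < k.+1) sel_value beta x j.
Proof.
elim: k => [|k IHk]; first by rewrite big_ord1.
rewrite big_ord_recr /= -IHk /sel_value /sel_time /=.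
by case: (selection beta x k).
Qed.

Lemma sel_time0 beta x : sel_time beta x 0 = Some 0%N.
Proof. by []. Qed.

Lemma sel_timeS beta x k :
  sel_time beta x k.+1 =
  obind (fun i => first_exceed x i (beta * sel_mean beta x k.+1))
    (sel_time beta x k).
Proof.
rewrite /sel_mean -selection_sum /sel_time /=.
by case: (selection beta x k) => t s /=; rewrite [s / _]mulrC.
Qed.

End selection_rule.

(* E(g | A) for an event A. *)
Definition expectation_given (R : realType) (d : measure_display)
    (T : measurableType d) (P : probability T R) (g : T -> R) (A : set T)
    : \bar R :=
  ((\int[P]_(w in A) (g w)%:E) * ((fine (P A))^-1)%:E)%E.

(* E(Z(a)^n), where Z(a) is distributed as X - a given X > a. *)
Definition overshoot_moment (R : realType) (d : measure_display)
    (T : measurableType d) (P : probability T R) (X : {RV P >-> R})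
    (n : nat) (a : R) : \bar R :=
  expectation_given P (fun w => (X w - a) ^+ n) [set w | a < X w].

Definition mean_overshoot (R : realType) (d : measure_display)
    (T : measurableType d) (P : probability T R) (X : {RV P >-> R})
    (a : R) : R :=
  fine (overshoot_moment X 1 a).

Definition gumbel_attraction (R : realType) (F : R -> R) : Prop :=
  exists a b : nat -> R, (forall n, 0 < a n) /\
    forall x, (F (a n * x + b n)) ^+ n @[n --> \oo] --> expR (- expR (- x)).

(* Absolute continuity on the open half-line (c, +oo) with derivative g, in the
   local sense: h is the indefinite Lebesgue integral of g on every compact
   subinterval. *)
Definition abs_continuous_on_ray (R : realType) (c : R) (h g : R -> R) : Prop :=
  forall a b, c < a -> a <= b ->
    lebesgue_measure.-integrable `[a, b] (EFin \o g) /\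
    h b - h a = \int[lebesgue_measure]_(u in `[a, b]) g u.

(* Von Mises function with x_F = +oo and constants x0, r.  The integral of
   1 / fA is taken in the extended reals since fA may vanish at x0. *)
Definition von_mises (R : realType) (F : R -> R) (x0 r : R) : Prop :=
  [/\ gumbel_attraction F,
      0 < r &
      exists fA fA' : R -> R,
        [/\ forall u, x0 < u -> 0 < fA u,
            abs_continuous_on_ray x0 fA fA',
            fA' u @[u --> +oo] --> (0 : R) &
            forall x, x0 < x ->
              (1 - F x)%:E =
              (r%:E * expeR (- \int[lebesgue_measure]_(u in `]x0, x[)
                                 ((fA u)^-1)%:E))%E]].

Definition G_fun (R : realType) (f : R -> R) (x0 r x : R) : R :=
  - ln (r * expR (- \int[lebesgue_measure]_(u in `]x0, x[) (f u)^-1)).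

(* The inverse of G on (x0, +oo); arbitrary outside the range of G. *)
Definition G_inv (R : realType) (f : R -> R) (x0 r : R) : R -> R :=
  pinv `]x0, +oo[ (G_fun f x0 r).

(* Main.v *)
Require Import Defs.
From HB Require Import structures.
From mathcomp Require Import all_boot all_order all_algebra finmap.
From mathcomp Require Import ring lra.
From mathcomp Require Import all_classical all_reals all_analysis.
From mathcomp Require Import measurable_realfun.

Import Order.TTheory GRing.Theory Num.Theory.
Import numFieldNormedType.Exports.

Local Open Scope classical_set_scope.
Local Open Scope ring_scope.

(* Write a for the current average, k for the number of selections so far, f for
   the mean overshoot and t for its tail P(X > a). Observed in real time, the pair
   (k, a) is a Markov chain driven by the i.i.d. observations, and the overshoots
   centred by f(a) and weighted by 1/(k+1) are martingale increments. With w their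
   partial sum, w^2 + C/k is a nonnegative supermartingale as soon as the second
   moment of the overshoot is at most C; freezing w when |w| reaches eps turns this
   into a maximal inequality, hence into almost sure convergence of w. Since f is
   nonincreasing, t(a + 2 f(a)) <= t(a) / 2, so a finite second moment of the
   overshoot is automatically bounded.
   So a moves by f(a)/(k+1) up to a convergent sum, and g_k = G^-1(log k) moves by
   f(g_k)/(k+1) up to a convergent sum. As f is nonincreasing, the drift of
   a - g_k always points towards 0, and such a sequence converges. *)

(** * Recursions driven by an independent sequence *)

(** For fixed [D] both sides are finite measures in [C] that agree on measurable rectangles, a
    pi-system generating the product sigma-algebra. *)
Lemma indep_event_pair {R : realType} {d d1 d2} {T : measurableType d}
    {T1 : measurableType d1} {T2 : measurableType d2} (P : probability T R)
    (W : T -> T1 * T2) (D : set T) :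
  measurable_fun setT W -> measurable D ->
  (forall A B, measurable A -> measurable B ->
    P (W @^-1` (A `*` B) `&` D) = (P (W @^-1` (A `*` B)) * P D)%E) ->
  forall C, measurable C -> P (W @^-1` C `&` D) = (P (W @^-1` C) * P D)%E.
Proof.
move=> mW mD WD C mC.
have PD0 : 0 <= fine (P D) by exact: fine_ge0.
have PDE : (fine (P D))%:E = P D by rewrite fineK ?fin_num_measure.
pose rect : set (set (T1 * T2)) :=
  [set A `*` B | A in measurable & B in measurable].
rewrite muleC -PDE.
apply: (measure_unique rect (fun=> setT) _ _ _ _
  (pushforward (mrestr P mD) W) (mscale (NngNum PD0) (pushforward P W))) => //.
- exact: measurable_prod_measurableType.
- move=> _ _ [A1 mA1 [A2 mA2 <-]] [B1 mB1 [B2 mB2 <-]].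
  rewrite -setXI; exists (A1 `&` B1); first exact: measurableI.
  by exists (A2 `&` B2) => //; exact: measurableI.
- by move=> _; exists setT => //; exists setT => //; rewrite setXTT.
- by rewrite bigcup_const.
- move=> _ [A mA [B mB <-]].
  by rewrite /= /mscale/= /pushforward/= /mrestr/= WD// muleC PDE.
- move=> _; rewrite /= /pushforward /= preimage_setT /mrestr setTI.
  by rewrite (le_lt_trans (probability_le1 _ _))// ltry.
Qed.

Section chain.
Context {R : realType} {d d'} {T : measurableType d} {E : measurableType d'}
  (P : probability T R) (X : nat -> {RV P >-> R}) (c : R -> E) (h : E * R -> E).
Hypotheses (mc : measurable_fun setT c) (mh : measurable_fun setT h).

(** State [n] has absorbed the observations [0] to [n]; the next step consumes number [n.+1]. *)
Fixpoint chain (x : nat -> R) (n : nat) : E :=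
  if n is n'.+1 then h (chain x n', x n) else c (x 0%N).

Definition chainX (n : nat) (w : T) : E := chain (fun i => X i w) n.

Lemma measurable_chainX n : measurable_fun setT (chainX n).
Proof.
elim: n => [|n IHn]; first exact: (measurableT_comp mc).
apply: (measurableT_comp mh); exact: measurable_fun_pair.
Qed.

Hypothesis X_indep : mutually_independent X.

Let cyl (J : {fset nat}) (B : nat -> set R) :=
  \bigcap_(i in [set` J]) (X i @^-1` B i).

Let measurable_cyl J B :
  (forall i, i \in J -> measurable (B i)) -> measurable (cyl J B).
Proof.
move=> mB; apply: fin_bigcap_measurable => // i iJ.
by rewrite -[_ @^-1` _]setTI; apply: measurable_funPT => //; exact: mB.
Qed.

(** A state depends only on the observations already absorbed, hence is independent of cylinders
    over later indices. The induction moves one observation at a time out of the state and into the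
    cylinder. *)
Let chainX_cyl n A J B : measurable A ->
    (forall i, i \in J -> (n < i)%N /\ measurable (B i)) ->
  P (chainX n @^-1` A `&` cyl J B) = (P (chainX n @^-1` A) * P (cyl J B))%E.
Proof.
have cylU m (C : set R) J' B' : m \notin J' ->
    X m @^-1` C `&` cyl J' B' =
    cyl (m |` J')%fset (fun i => if i == m then C else B' i).
  move=> mJ; apply/seteqP; split=> [w [Cw Bw] i /=|w Bw].
    rewrite in_fsetU in_fset1 => /orP[/eqP ->|iJ]; first by rewrite eqxx.
    by case: eqVneq => [->//|_]; exact: Bw.
  split; first by have := Bw m; rewrite /= in_fsetU in_fset1 !eqxx; exact.
  move=> i /= iJ; have := Bw i; rewrite /= in_fsetU iJ orbT => /(_ isT).
  by case: eqVneq => // im; rewrite -im iJ in mJ.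
have PcylU m (C : set R) J' B' : measurable C ->
    (forall i, i \in J' -> (m < i)%N /\ measurable (B' i)) ->
    P (X m @^-1` C `&` cyl J' B') = (P (X m @^-1` C) * P (cyl J' B'))%E.
  move=> mC J'B'.
  have mJ' : m \notin J' by apply/negP => /J'B'[]; rewrite ltnn.
  rewrite cylU// /cyl X_indep; last first.
    move=> i; rewrite in_fsetU in_fset1; case: eqVneq => //= _ /J'B'[]//.
  rewrite X_indep; last by move=> i /J'B'[].
  rewrite big_fsetU1//= eqxx; congr (_ * _)%E.
  rewrite [LHS]big_seq [RHS]big_seq; apply: eq_bigr => i iJ.
  by case: eqVneq => // im; rewrite -im iJ in mJ'.
elim: n => [|n IHn] in A J B * => mA JB.
  apply: (PcylU 0%N (c @^-1` A)) => //.
  by rewrite -[_ @^-1` _]setTI; exact: mc.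
pose W w := (chainX n w, X n.+1 w).
have mW : measurable_fun setT W.
  by apply: measurable_fun_pair => //; exact: measurable_chainX.
(* State [n.+1] is [h] of [W], so rectangles for [W] suffice; on them the induction hypothesis
   applies with [n.+1] added to [J]. *)
apply: (@indep_event_pair _ _ _ _ _ _ _ _ W _ _ _ _ (h @^-1` A)) => //.
- by apply: measurable_cyl => i /JB[].
- move=> A' B' mA' mB'.
  have -> : W @^-1` (A' `*` B') = chainX n @^-1` A' `&` X n.+1 @^-1` B' by [].
  have nJ : n.+1 \notin J by apply/negP => /JB[]; rewrite ltnn.
  rewrite -setIA cylU// IHn//; last first.
    move=> i; rewrite in_fsetU in_fset1; case: eqVneq => [->//|/= _ /JB[+ ?]].
    by move=> /ltnW.
  rewrite -cylU// PcylU// muleA; congr (_ * _)%E.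
  have -> : X n.+1 @^-1` B' = cyl [fset n.+1]%fset (fun=> B').
    by rewrite /cyl set_fset1 bigcap_set1.
  rewrite -IHn// => i; rewrite in_fset1 => /eqP ->; by split.
- by rewrite -[_ @^-1` _]setTI; exact: mh.
Qed.

(** Markov property: independence makes the joint law of the state and the next observation a
    product measure, and Tonelli's theorem integrates the observation first. *)
Lemma chainX_next (mu : probability R R) n
    (f : (E * R)%type -> \bar R) :
  (forall B, measurable B -> P (X n.+1 @^-1` B) = mu B) ->
  measurable_fun setT f -> (forall z, 0 <= f z)%E ->
  (\int[P]_w f (chainX n w, X n.+1 w) =
   \int[P]_w \int[mu]_x f (chainX n w, x))%E.
Proof.
move=> Xmu mf f0.
pose W w := (chainX n w, X n.+1 w).
have mC := measurable_chainX n.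
have mW : measurable_fun setT W by exact: measurable_fun_pair.
pose V := mfun_Sub (mem_set mC : chainX n \in mfun).
have WE C : measurable C ->
    (distribution P V \x mu)%E C = pushforward P W C.
  apply: (@product_measure_unique _ _ _ _ _ _ _ (pushforward P W)) => //.
  move=> A B mA mB; rewrite /= /pushforward.
  have -> : W @^-1` (A `*` B) =
      chainX n @^-1` A `&` cyl [fset n.+1]%fset (fun=> B).
    by rewrite /cyl set_fset1 bigcap_set1.
  rewrite chainX_cyl//; last by move=> i; rewrite in_fset1 => /eqP ->; split.
  by rewrite /cyl set_fset1 bigcap_set1 Xmu.
transitivity (\int[pushforward P W]_z f z)%E.
  by rewrite ge0_integral_pushforward.
transitivity (\int[distribution P V \x mu]_z f z)%E.
  by apply: eq_measure_integral => C mC' _; exact: (esym (WE _ _)).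
rewrite fubini_tonelli1// (@ge0_integral_distribution _ _ _ _ _ _ V)//.
- exact: measurable_fun_fubini_tonelli_F.
- by move=> y; apply: integral_ge0.
Qed.

(** The last hypothesis makes [f] superharmonic for the transition kernel, so by the Markov property
    its expectation along the chain never increases. *)
Lemma chainX_supermartingale (mu : probability R R)
    (f : E -> \bar R) n :
  (forall n B, measurable B -> P (X n @^-1` B) = mu B) ->
  measurable_fun setT f -> (forall v, 0 <= f v)%E ->
  (forall v, \int[mu]_x f (h (v, x)) <= f v)%E ->
  (\int[P]_w f (chainX n w) <= \int[mu]_x f (c x))%E.
Proof.
move=> Xmu mf f0 fh; elim: n => [|n IHn].
  rewrite -(ge0_integral_distribution (X 0%N) (f := fun x => f (c x)))//.
    by rewrite (eq_measure_integral mu)// => A mA _; exact: Xmu.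
  by apply: measurableT_comp => //; exact: mc.
apply: le_trans IHn.
have mfh : measurable_fun setT (fun z => f (h z)) by exact: measurableT_comp.
have -> : (\int[P]_w f (chainX n.+1 w) =
   \int[P]_w \int[mu]_x f (h (chainX n w, x)))%E.
  by apply: (chainX_next _ _ (fun z => f (h z))) => // B; exact: Xmu.
apply: ge0_le_integral => //.
- by move=> w _; apply: integral_ge0.
- apply: (@measurableT_comp _ _ _ _ _ _
    (fun v => \int[mu]_x f (h (v, x)))%E _ (chainX n)).
    exact: (measurable_fun_fubini_tonelli_F _ mfh).
  exact: measurable_chainX.
- by apply: measurableT_comp => //; exact: measurable_chainX.
Qed.

End chain.

(** * The chain of selections and its martingale *)

Section integrable_EFin.
Context {R : realType} (mu : probability R R).

Lemma integrable_EFinD (g1 g2 : R -> R) :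
  mu.-integrable setT (EFin \o g1) -> mu.-integrable setT (EFin \o g2) ->
  mu.-integrable setT (EFin \o (fun x => g1 x + g2 x)).
Proof. by move=> gi1 gi2; exact: (integrableD _ gi1 gi2). Qed.

Lemma integrable_EFinB (g1 g2 : R -> R) :
  mu.-integrable setT (EFin \o g1) -> mu.-integrable setT (EFin \o g2) ->
  mu.-integrable setT (EFin \o (fun x => g1 x - g2 x)).
Proof. by move=> gi1 gi2; exact: (integrableB _ gi1 gi2). Qed.

Lemma integrable_EFinZ (r : R) (g : R -> R) :
  mu.-integrable setT (EFin \o g) ->
  mu.-integrable setT (EFin \o (fun x => r * g x)).
Proof.
move=> gi; rewrite (_ : _ \o _ = (fun x => r%:E * (g x)%:E)%E)//.
exact: (integrableZl _ r).
Qed.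

Lemma integrable_EFin_cst (r : R) : mu.-integrable setT (EFin \o (fun=> r)).
Proof. exact: finite_measure_integrable_cst. Qed.

End integrable_EFin.

Section record_chain.
Context {R : realType}.
Implicit Types (psi : R -> R -> R) (live : nat -> R -> bool).

(* The state is (number of selections, average selected value, w); a selection
   of x adds [psi a x / (k+1)] to w as long as w is live. *)
Definition rec_step psi live (z : (nat * R * R) * R) : nat * R * R :=
  if z.1.1.2 < z.2 then
    (z.1.1.1.+1, z.1.1.2 + (z.2 - z.1.1.2) / z.1.1.1.+1%:R,
     if live z.1.1.1 z.1.2 then z.1.2 + psi z.1.1.2 z.2 / z.1.1.1.+1%:R
     else z.1.2)
  else z.1.

Definition rec_init (x : R) : nat * R * R := (1%N, x, 0).

(** Freezing switch: increments of [w] count only from selection [k0] on, and stop for good once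
    [|w|] has reached [eps]. The current [w] thus remembers whether the level was ever reached. *)
Definition below (k0 : nat) (eps : R) (k : nat) (w : R) : bool :=
  (k0 <= k)%N && (`|w| < eps).

Lemma measurable_rec_init : measurable_fun setT rec_init.
Proof. by do !apply: measurable_fun_pair. Qed.

Lemma measurable_rec_step psi k0 eps :
  measurable_fun setT (fun z : R * R => psi z.1 z.2) ->
  measurable_fun setT (rec_step psi (below k0 eps)).
Proof.
move=> mpsi.
have m11 : measurable_fun setT (fun z : (nat * R * R) * R => z.1.1).
  exact: (measurableT_comp measurable_fst).
have mk : measurable_fun setT (fun z : (nat * R * R) * R => z.1.1.1).
  exact: (measurableT_comp measurable_fst).
have ma : measurable_fun setT (fun z : (nat * R * R) * R => z.1.1.2).
  exact: (measurableT_comp measurable_snd).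
have mw : measurable_fun setT (fun z : (nat * R * R) * R => z.1.2).
  exact: (measurableT_comp measurable_snd).
have mx : measurable_fun setT (fun z : (nat * R * R) * R => z.2).
  exact: measurable_snd.
have mkf (d : measure_display) (V : measurableType d) (f : nat -> V) :
    measurable_fun setT (fun z : (nat * R * R) * R => f z.1.1.1).
  by apply: (@measurableT_comp _ _ _ _ _ _ f).
have mS : measurable_fun setT (fun z : (nat * R * R) * R => z.1.1.1.+1%:R^-1 : R).
  exact: mkf (fun k => k.+1%:R^-1 : R).
apply: measurable_fun_ifT => //; first exact: measurable_fun_ltr.
apply: measurable_fun_pair; first apply: measurable_fun_pair.
- exact: mkf S.
- apply: measurable_funD => //; apply: measurable_funM => //.
  exact: measurable_funB.
- apply: measurable_fun_ifT => //.
  + apply: measurable_and.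
      exact: mkf (leq k0).
    apply: measurable_fun_ltr => //.
    exact: measurableT_comp.
  + apply: measurable_funD => //; apply: measurable_funM => //.
    apply: (measurableT_comp (f := fun z : R * R => psi z.1 z.2)
      (g := fun z : (nat * R * R) * R => (z.1.1.2, z.2))) => //.
    exact: measurable_fun_pair.
Qed.

End record_chain.

(** * The supermartingale potential *)

Section rec_potential.
Context {R : realType} (mu : probability R R).
Variables (psi : R -> R -> R) (C : R).
Hypotheses (C0 : 0 <= C)
  (psi_supp : forall a x, x <= a -> psi a x = 0)
  (psi_int : forall a, mu.-integrable setT (EFin \o psi a))
  (psi_mean : forall a, \int[mu]_x psi a x = 0)
  (psi_int2 : forall a, mu.-integrable setT (EFin \o (fun x => psi a x ^+ 2)))
  (psi_var : forall a,
    \int[mu]_x (psi a x ^+ 2) <= C * fine (mu `]a, +oo[%classic)).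

(** [C / k] pays for the variance still to come. The [maxn] holds it at [C / k0] while the
    increments are switched off, so that the initial value is small for large [k0]. *)
Definition rec_potential k0 (v : nat * R * R) : R :=
  v.2 ^+ 2 + C / (maxn v.1.1 k0)%:R.

Lemma rec_potential_ge0 k0 v : 0 <= rec_potential k0 v.
Proof. by rewrite addr_ge0 ?sqr_ge0 ?divr_ge0. Qed.

Lemma measurable_rec_potential k0 : measurable_fun setT (rec_potential k0).
Proof.
apply: measurable_funD; first exact: measurable_funX.
apply: (measurableT_comp (f := fun k : nat => C / (maxn k k0)%:R)) => //.
by apply: measurableT_comp.
Qed.

(** When live, the cross term has mean zero, and the expected square is covered by the fall of
    [C / k], both weighted by the probability of a selection. When switched off, only the term in
    [C] can move, and it moves downwards. *)
Lemma rec_potential_step k0 eps v : (0 < k0)%N ->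
  (\int[mu]_x (rec_potential k0 (rec_step psi (below k0 eps) (v, x)))%:E
   <= (rec_potential k0 v)%:E)%E.
Proof.
move=> k0_gt0; case: v => -[k a] w.
have cstE (r : R) : (\int[mu]_x r%:E = r%:E)%E.
  by rewrite integral_cst//= probability_setT mule1.
have [live|dead] := boolP (below k0 eps k w); last first.
  rewrite -[leRHS]cstE; apply: ge0_le_integral => //.
  - by move=> x _; rewrite lee_fin rec_potential_ge0.
  - apply/measurable_EFinP; rewrite /rec_step /= (negbTE dead).
    rewrite /rec_potential.
    under eq_fun do rewrite (fun_if snd) (fun_if fst) (fun_if fst) /= if_same.
    apply: measurable_funD => //.
    apply: (measurableT_comp (f := fun k : nat => C / (maxn k k0)%:R)) => //.
    apply: measurable_fun_ifT => //; exact: measurable_fun_ltr.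
  - move=> x _; rewrite lee_fin /rec_step /= (negbTE dead) /rec_potential.
    case: ifP => //= _; rewrite lerD2l ler_wpM2l// 
      lef_pV2 ?posrE ?ltr0n ?leq_max ?k0_gt0 ?orbT//.
    by rewrite ler_nat geq_max !leq_max leqnSn leqnn orbT.
have k0k : (k0 <= k)%N by case/andP: live.
have k_gt0 : 0 < k%:R :> R by rewrite ltr0n (leq_trans k0_gt0).
have k1_gt0 : 0 < k.+1%:R :> R by [].
pose c : R := k.+1%:R^-1.
pose p := fine (mu `]a, +oo[%classic).
pose delta := C / k%:R - C / k.+1%:R.
(* As [psi a] vanishes up to [a], a single formula covers both selection and rejection. *)
have stepE x : rec_potential k0 (rec_step psi (below k0 eps) (k, a, w, x)) =
    ((w ^+ 2 + C / k%:R) + 2 * w * c * psi a x) +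
    (c ^+ 2 * psi a x ^+ 2 - delta * \1_(`]a, +oo[%classic) x).
  rewrite /rec_step /= live /rec_potential indicE mem_setE in_itv/= andbT.
  have [ax|xa] := ltP a x; rewrite /= !(maxn_idPl _) ?(leq_trans k0k)//.
    rewrite /delta -/c. ring.
  by rewrite psi_supp//; ring.
have mA : measurable (`]a, +oo[%classic : set R) by [].
have int_1 : mu.-integrable setT (EFin \o (\1_(`]a, +oo[%classic) : R -> R)).
  exact: integrable_indic.
under eq_integral do rewrite stepE.
have i1 := integrable_EFinD mu _ _ (integrable_EFin_cst mu (w ^+ 2 + C / k%:R))
  (integrable_EFinZ mu (2 * w * c) _ (psi_int a)).
have i2 := integrable_EFinB mu _ _ (integrable_EFinZ mu (c ^+ 2) _ (psi_int2 a))
  (integrable_EFinZ mu delta _ int_1).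
have i3 := integrable_EFinD mu _ _ i1 i2.
rewrite -[leLHS]fineK; last exact: integrable_fin_num i3.
rewrite lee_fin -/(Rintegral _ _ _) RintegralD// RintegralD//;
  do ?[exact: integrable_EFin_cst|exact: integrable_EFinZ].
rewrite RintegralB//; do ?exact: integrable_EFinZ.
rewrite !RintegralZl// psi_mean Rintegral_cst//.
have mu1 : fine (mu setT) = 1 by rewrite probability_setT.
rewrite [X in _ * X + _]mu1 mulr1.
have -> : \int[mu]_x \1_(`]a, +oo[%classic) x = p.
  by rewrite /Rintegral integral_indic// setIT.
rewrite mulr0 addr0 /rec_potential /= (maxn_idPl k0k) gerDl.
have p0 : 0 <= p by exact: fine_ge0.
(* This is [1 / (k + 1) ^ 2 <= 1 / k - 1 / (k + 1)], scaled by [C]. *)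
have c2 : c ^+ 2 * C <= delta.
  rewrite /delta /c -natr1 in k1_gt0 *.
  have -> : C / k%:R - C / (k%:R + 1) = (k%:R * (k%:R + 1))^-1 * C.
    by field; rewrite !gt_eqF.
  rewrite ler_wpM2r// exprVn lef_pV2 ?posrE ?exprn_gt0 ?mulr_gt0//.
  by rewrite expr2 ler_pM2r ?lerDl.
rewrite subr_le0; apply: (@le_trans _ _ (c ^+ 2 * (C * p))).
  by rewrite ler_wpM2l ?sqr_ge0.
by rewrite mulrA ler_wpM2r.
Qed.

End rec_potential.
Lemma cauchy_tail_cvgn {R : realType} (u : nat -> R) :
  (forall e, 0 < e -> exists N, forall n, (N <= n)%N -> `|u n - u N| < e) ->
  cvgn u.
Proof.
move=> u_tail; apply: cauchy_cvg; apply: cauchy_exP => e e0.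
have [N uN] := u_tail e e0; exists (u N).
by exists N => // n /= Nn; rewrite -ball_normE /= distrC uN.
Qed.

Section rec_path.
Context {R : realType}.
Implicit Types (psi : R -> R -> R) (x : nat -> R).

Definition rec_chain psi x n : nat * R * R :=
  chain rec_init (rec_step psi (fun _ _ => true)) x n.

(** Weight and switch never influence count and average, so all chains driven by one sequence share
    these two components. *)
Lemma chain_rec_step1 psi live psi' live' x n :
  (chain rec_init (rec_step psi live) x n).1 =
  (chain rec_init (rec_step psi' live') x n).1.
Proof.
elim: n => //= n IHn.
rewrite /rec_step /= IHn.
by case: ifP.
Qed.

Lemma rec_chain_count_nd psi x m n : (m <= n)%N ->
  ((rec_chain psi x m).1.1 <= (rec_chain psi x n).1.1)%N.
Proof.
move=> /subnK <-; elim: (n - m)%N => // k IHk; apply: leq_trans IHk _.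
by rewrite addSn /rec_chain /= /rec_step /=; case: ifP.
Qed.

Lemma rec_chain_cvg psi x :
  (forall k, exists n, (k <= (rec_chain psi x n).1.1)%N) ->
  (forall j, exists2 k0, (0 < k0)%N & forall n,
    `|(chain rec_init (rec_step psi (below k0 j.+1%:R^-1)) x n).2| < j.+1%:R^-1) ->
  cvgn (fun n => (rec_chain psi x n).2).
Proof.
move=> cnt_oo tail; apply: cauchy_tail_cvgn => e e0.
have [j je] : exists j : nat, j.+1%:R^-1 < e / 2.
  exists (Num.bound (2 / e)); rewrite -[ltRHS]invrK.
  rewrite ltf_pV2 ?posrE ?invr_gt0 ?divr_gt0//.
  rewrite invf_div (lt_trans (archi_boundP _))// ?divr_ge0// ?ltW//.
  by rewrite ltr_nat.
have [k0 k0_gt0 small] := tail j; set eps := j.+1%:R^-1 in je small.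
have [N k0N] := cnt_oo k0; exists N => n Nn.
pose fr := chain rec_init (rec_step psi (below k0 eps)) x.
have -> : (rec_chain psi x n).2 - (rec_chain psi x N).2 = (fr n).2 - (fr N).2.
  rewrite -(subnK Nn); elim: (n - N)%N => [|m IHm]; first by rewrite !subrr.
  have fr1 i : (fr i).1 = (rec_chain psi x i).1 by exact: chain_rec_step1.
  have live : below k0 eps (rec_chain psi x (m + N)).1.1 (fr (m + N)%N).2.
    by rewrite /below small andbT (leq_trans k0N)// rec_chain_count_nd// leq_addl.
  move: IHm; rewrite addSn /rec_chain /fr /=.
  rewrite -/(fr (m + N)%N) -/(rec_chain psi x (m + N)).

  rewrite {3 5}/rec_step /= fr1 live; case: ifP => //= _ IHm.
  by rewrite addrAC IHm addrAC.
rewrite (le_lt_trans (ler_normB _ _))// (splitr e).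
by rewrite ltrD// (lt_trans (small _)).
Qed.

End rec_path.

(** * Maximal inequality and almost sure convergence *)

Section rec_martingale.
Context {R : realType} {d} {T : measurableType d} (P : probability T R)
  (X : nat -> {RV P >-> R}) (mu : probability R R).
Hypotheses (X_indep : mutually_independent X)
  (Xmu : forall n B, measurable B -> P (X n @^-1` B) = mu B).
Variables (psi : R -> R -> R) (C : R).
Hypotheses (C0 : 0 <= C)
  (psi_meas : measurable_fun setT (fun z : R * R => psi z.1 z.2))
  (psi_supp : forall a x, x <= a -> psi a x = 0)
  (psi_int : forall a, mu.-integrable setT (EFin \o psi a))
  (psi_mean : forall a, \int[mu]_x psi a x = 0)
  (psi_int2 : forall a, mu.-integrable setT (EFin \o (fun x => psi a x ^+ 2)))
  (psi_var : forall a,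
    \int[mu]_x (psi a x ^+ 2) <= C * fine (mu `]a, +oo[%classic)).

Let frozen k0 eps n w :=
  (chainX P X rec_init (rec_step psi (below k0 eps)) n w).2.

Let measurable_frozen k0 eps n : measurable_fun setT (frozen k0 eps n).
Proof.
apply: (measurableT_comp measurable_snd); apply: measurable_chainX.
  exact: measurable_rec_init.
exact: measurable_rec_step.
Qed.

Let exceed k0 eps n := [set w | eps <= `|frozen k0 eps n w|].

Let measurable_exceed k0 eps n : measurable (exceed k0 eps n).
Proof.
rewrite -[exceed _ _ _]setTI.
have := measurable_fun_ler (measurable_cst eps)
  (measurableT_comp (@normr_measurable R setT) (measurable_frozen k0 eps n)).
by move=> /(_ measurableT [set true] I).
Qed.

(** Markov's inequality for the potential, which is at least [eps ^+ 2] on the event and starts at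
    [C / k0]. *)
Let P_exceed k0 eps n : (0 < k0)%N -> 0 < eps ->
  (P (exceed k0 eps n) <= (C / (k0%:R * eps ^+ 2))%:E)%E.
Proof.
move=> k0_gt0 e0.
have e2 : 0 < eps ^+ 2 by rewrite exprn_gt0.
pose Phi v := (rec_potential C k0 v)%:E.
have Phi0 v : (0 <= Phi v)%E by rewrite lee_fin rec_potential_ge0.
have mPhi : measurable_fun setT Phi.
  by apply/measurable_EFinP; exact: measurable_rec_potential.
have ub : (\int[P]_w Phi (chainX P X rec_init (rec_step psi (below k0 eps)) n w)
    <= (C / k0%:R)%:E)%E.
  have -> : (C / k0%:R)%:E = (\int[mu]_x Phi (rec_init x))%E.
    rewrite /Phi /rec_potential /= (maxn_idPr k0_gt0) expr0n add0r.
    by rewrite integral_cst//= probability_setT mule1.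
  apply: chainX_supermartingale => //.
  - exact: measurable_rec_init.
  - exact: measurable_rec_step.
  - by move=> v; exact: rec_potential_step.
have : ((eps ^+ 2)%:E * P (exceed k0 eps n) <= (C / k0%:R)%:E)%E.
  apply: le_trans ub.
  rewrite -[X in (_ * P X)%E]setIT -integral_indic//.
  have e2' := ltW e2.
  rewrite -ge0_integralZl_EFin//; last exact/measurable_EFinP.
  apply: ge0_le_integral => //.
  - by move=> w _; rewrite -EFinM lee_fin mulr_ge0.
  - by apply: measurable_funeM; exact/measurable_EFinP.
  - apply: measurableT_comp => //; apply: measurable_chainX => //.
      exact: measurable_rec_init.
    exact: measurable_rec_step.
  - move=> w _; rewrite -EFinM lee_fin indicE.
    have [|_] := boolP (w \in exceed k0 eps n); last first.
      by rewrite mulr0 rec_potential_ge0.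
    rewrite inE /exceed /= mulr1 => ew; rewrite /rec_potential.
    rewrite -[leLHS]addr0 lerD ?divr_ge0//.
    by rewrite -[leRHS]real_normK ?num_real// lerXn2r ?nnegrE// ltW.
rewrite muleC -lee_pdivlMr// -EFinM => /le_trans; apply.
by rewrite lee_fin -mulrA -invfM.
Qed.

(** Freezing makes the events increase with [n], so the bound at one time becomes, by continuity of
    the measure, a maximal inequality over all times. *)
Let P_bigcup_exceed k0 eps : (0 < k0)%N -> 0 < eps ->
  (P (\bigcup_n exceed k0 eps n) <= (C / (k0%:R * eps ^+ 2))%:E)%E.
Proof.
move=> k0_gt0 e0.
have nd : nondecreasing_seq (exceed k0 eps).
  apply/nondecreasing_seqP => n; apply/subsetPset => w.
  rewrite /exceed /= /frozen /chainX /=; set v := chain _ _ _ _ => ev.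
  rewrite /rec_step /= /below [X in _ && X]ltNge ev andbF.
  by case: ifP.
have cv : P (exceed k0 eps n) @[n --> \oo] --> P (\bigcup_n exceed k0 eps n).
  by apply: nondecreasing_cvg_mu => //; exact: bigcupT_measurable.
rewrite -(cvg_lim _ cv)//; apply: lime_le; first exact: (cvgP _ cv).
by apply: nearW => n; exact: P_exceed.
Qed.

Lemma ae_rec_chain_cvg :
  {ae P, forall w k, exists n,
    (k <= (rec_chain psi (fun i => X i w) n).1.1)%N} ->
  {ae P, forall w, cvgn (fun n => (rec_chain psi (fun i => X i w) n).2)}.
Proof.
move=> cnt_oo.
have tail : {ae P, forall w j, exists2 k0, (0 < k0)%N &
    forall n, `|frozen k0 j.+1%:R^-1 n w| < j.+1%:R^-1}.
  apply/ae_foralln => j; set e : R := j.+1%:R^-1.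
  have e0 : 0 < e by rewrite invr_gt0.
  (* Failure for every starting index [k.+1] has probability at most [C / (k.+1 * e ^ 2)] for each
     [k], hence zero. *)
  pose N := \bigcap_k (\bigcup_n exceed k.+1 e n).
  exists N; split.
  - by apply: bigcapT_measurable => k; exact: bigcupT_measurable.
  - apply/eqP; rewrite eq_le measure_ge0 andbT; apply/lee_addgt0Pr => /= eta eta0.
    rewrite add0e.
    have [k Ck] : exists k : nat, C / e ^+ 2 / eta < k.+1%:R.
      exists (Num.bound (C / e ^+ 2 / eta)); apply: lt_trans (archi_boundP _) _.
        by rewrite !divr_ge0// ?ltW// exprn_gt0.
      by rewrite ltr_nat.
    apply: (@le_trans _ _ (P (\bigcup_n exceed k.+1 e n))).
      apply: le_measure; rewrite ?inE//.
      + by apply: bigcapT_measurable => ?; exact: bigcupT_measurable.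
      + exact: bigcupT_measurable.
      + by move=> w; exact.
    apply: le_trans (P_bigcup_exceed _ _ _ _) _ => //; rewrite lee_fin.
    have e2 : 0 < e ^+ 2 by rewrite exprn_gt0.
    move: Ck; rewrite !ltr_pdivrMr// => /ltW.
    rewrite ler_pdivrMr ?mulr_gt0// => /le_trans; apply.
    by rewrite [leRHS]mulrC mulrAC.
  - move=> w /= wN k _; apply: contrapT => noexc; apply: wN.
    exists k.+1 => // n; rewrite ltNge; apply/negP => ex; apply: noexc.
    by exists n.
apply: filterS2 cnt_oo tail => w cw tw; exact: rec_chain_cvg.
Qed.

End rec_martingale.

(** * Real time and selection numbers *)

Section selection_path.
Context {R : realType}.
Implicit Types (psi : R -> R -> R) (x : nat -> R).

Lemma first_exceed_next x t n c : (t <= n)%N ->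
  (forall i, (t < i <= n)%N -> x i <= c) -> c < x n.+1 ->
  first_exceed x t c = Some n.+1.
Proof.
move=> tn noexc cx; rewrite /first_exceed.
case: pselect => [ex|/(_ (ex_intro _ n.+1 _))[]]; last by rewrite ltnS tn.
congr Some; case: ex_minnP => m /andP[tm cm] minm.
apply/eqP; rewrite eqn_leq minm ?ltnS ?tn//= ltnNge; apply/negP => mn.
by have := noexc m; rewrite tm mn leNgt cm => /(_ isT).
Qed.

(** The witness [t] is the time of the last selection. That no later observation exceeds the average
    is carried along because it identifies the next jump of the chain with [first_exceed]. *)
Lemma rec_chain_selection psi x n : exists2 t,
  (exists2 k, (rec_chain psi x n).1.1 = k.+1 &
     selection 1 x k = (Some t, (rec_chain psi x n).1.2 * k.+1%:R)) &
  (t <= n)%N /\ forall i, (t < i <= n)%N -> x i <= (rec_chain psi x n).1.2.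
Proof.
elim: n => [|n [t [k kE selE] [tn noexc]]].
  exists 0%N; first by exists 0%N; rewrite //= mulr1.
  by split=> // i /andP[/leq_trans/[apply]]; rewrite ltnn.
rewrite /rec_chain /= -/(rec_chain psi x n) /rec_step /= kE.
case: ifP => [ax|xa]; last first.
  exists t; first by exists k.
  split=> [|i /andP[ti]]; first exact: leqW.
  rewrite leq_eqVlt => /predU1P[->|i_n]; first by rewrite leNgt xa.
  by apply: noexc; rewrite ti.
exists n.+1; last by split=> // i /andP[/leq_trans/[apply]]; rewrite ltnn.
exists k.+1 => //=; rewrite selE /= mul1r mulfK// (first_exceed_next _ _ _ _ tn)//=.
(* Adding [(x - a) / (k + 2)] to the average [a] of [k + 1] values gives the average of [k + 2]
   values. *)
congr pair; rewrite mulrDl -mulrA mulVf// mulr1 -[X in _ = _ * X + _]natr1.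
ring.
Qed.

Lemma sel_mean_rec_chain psi x n :
  sel_mean 1 x (rec_chain psi x n).1.1 = (rec_chain psi x n).1.2.
Proof.
have [t [k -> selE] _] := rec_chain_selection psi x n.
by rewrite /sel_mean -selection_sum selE /= mulrC mulfK.
Qed.

(** If no observation exceeded the average any more, the average would stay constant, against the
    unboundedness of [x]. *)
Lemma rec_chain_count_unbounded psi x :
  (forall n0 N : nat, exists2 n, (n0 <= n)%N & N%:R < x n) ->
  forall k, exists n, (k <= (rec_chain psi x n).1.1)%N.
Proof.
move=> xoo; elim=> [|k [n0 kn0]]; first by exists 0%N.
have [[n n0n ax]|] := pselect (exists2 n, (n0 <= n)%N &
    (rec_chain psi x n).1.2 < x n.+1).
  exists n.+1; rewrite /rec_chain /= -/(rec_chain psi x n) /rec_step /= ax /=.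
  by rewrite ltnS (leq_trans kn0)// rec_chain_count_nd.
move=> noexc.
have a_cst m : (rec_chain psi x (m + n0)).1.2 = (rec_chain psi x n0).1.2.
  elim: m => // m IHm.
  rewrite addSn /rec_chain /= -/(rec_chain psi x (m + n0)) /rec_step /=.
  by case: ifP => // ax; exfalso; apply: noexc;
    exists (m + n0)%N; rewrite ?leq_addl.
set a := (rec_chain psi x n0).1.2 in a_cst.
have [n n0n nx] := xoo n0.+1 (Num.bound `|a|).
exfalso; apply: noexc; case: n n0n nx => // n n0n nx; exists n => //.
rewrite -(subnK (_ : n0 <= n)%N)// a_cst subnK//.
apply: lt_trans nx; apply: (le_lt_trans (ler_norm a)).
by have := archi_boundP (normr_ge0 a).
Qed.

(** The count grows by at most one per step, so it skips no value above the current one. *)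
Lemma rec_chain_count_hits psi x n0 k :
  (forall k, exists n, (k <= (rec_chain psi x n).1.1)%N) ->
  ((rec_chain psi x n0).1.1 < k)%N ->
  exists2 n, (n0 <= n)%N & (rec_chain psi x n).1.1 = k.
Proof.
move=> coo n0k; case: (ex_minnP (coo k)) => m km minm.
have n0m : (n0 < m)%N.
  rewrite ltnNge; apply/negP => /(rec_chain_count_nd psi x) mn0.
  by have := leq_trans n0k (leq_trans km mn0); rewrite ltnn.
exists m; first exact: ltnW.
case: m km minm n0m => // m km minm _; apply/eqP; rewrite eqn_leq km andbT.
have : ((rec_chain psi x m).1.1 < k)%N.
  by rewrite ltnNge; apply/negP => /minm; rewrite ltnn.
rewrite /rec_chain /= -/(rec_chain psi x m) /rec_step /=.
by case: ifP => // _ /ltnW.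
Qed.

End selection_path.

(** By independence, [m] observations in a row stay at or below [N] with probability [p ^+ m], where
    [p < 1]. *)
Lemma ae_exceed {R : realType} {d} {T : measurableType d} (P : probability T R)
    (X : nat -> {RV P >-> R}) (mu : probability R R) :
  mutually_independent X ->
  (forall n B, measurable B -> P (X n @^-1` B) = mu B) ->
  (forall b, mu `]-oo, b]%classic < 1)%E ->
  {ae P, forall w, forall n0 N : nat, exists2 n, (n0 <= n)%N & N%:R < X n w}.
Proof.
move=> X_indep Xmu mu_lt1.
apply/ae_foralln => n0; apply/ae_foralln => N.
pose B : set R := `]-oo, N%:R]%classic.
have mB : measurable B by exact: measurable_itv.
have mXB n : measurable (X n @^-1` B).
  by rewrite -[_ @^-1` _]setTI; exact: measurable_funPT.
pose J m := seq_fset tt (iota n0 m).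
exists (\bigcap_(i in [set i | (n0 <= i)%N]) X i @^-1` B); split.
- by apply: bigcap_measurableType => i _.
- pose p := fine (mu B).
  have pE : p%:E = mu B by rewrite fineK ?fin_num_measure.
  have p0 : 0 <= p by exact: fine_ge0.
  have p1 : p < 1 by rewrite -lte_fin pE; exact: mu_lt1.
  have le_pX m : (P (\bigcap_(i in [set i | (n0 <= i)%N]) X i @^-1` B) <=
      (p ^+ m)%:E)%E.
    apply: (@le_trans _ _ (P (\bigcap_(i in [set` J m]) X i @^-1` B))).
      apply: le_measure; rewrite ?inE.
      - by apply: bigcap_measurableType => i _.
      - exact: fin_bigcap_measurable.
      - move=> w Bw i /=; rewrite seq_fsetE mem_iota => /andP[n0i _].
        exact: Bw.
    rewrite (X_indep (J m) (fun=> B))//.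
    under eq_bigr do rewrite Xmu// -pE.
    rewrite big_const_seq count_predT.
    have -> : size (J m) = m.
      by rewrite size_seq_fset undup_id ?iota_uniq// size_iota.
    by elim: m => //= m IHm; rewrite exprS EFinM lee_wpmul2l ?lee_fin.
  apply/eqP; rewrite eq_le measure_ge0 andbT; apply/lee_addgt0Pr => /= e e0.
  rewrite add0e.
  have /cvgrPdist_lt/(_ _ e0)[m _ /(_ _ (leqnn m))] : p ^+ m @[m --> \oo] --> 0.
    by apply: cvg_expr; rewrite ger0_norm.
  rewrite /= sub0r normrN ger0_norm ?exprn_ge0// => /ltW pe.
  by apply: le_trans (le_pX m) _; rewrite lee_fin.
- move=> w /= noexc i n0i; rewrite /B /= in_itv /= leNgt; apply/negP => Nx.
  by apply: noexc; exists i.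
Qed.
(** * Overshoots *)

Section overshoot.
Context {R : realType} (mu : probability R R).

Lemma integrable_EFin_le (g1 g2 : R -> R) :
  measurable_fun setT g1 -> mu.-integrable setT (EFin \o g2) ->
  (forall x, `|g1 x| <= g2 x) -> mu.-integrable setT (EFin \o g1).
Proof.
move=> mg1 ig2 g12; apply: (le_integrable _ _ _ ig2) => //.
  exact/measurable_EFinP.
by move=> x _; rewrite /= lee_fin (le_trans (g12 x))// ler_norm.
Qed.

Definition tail (a : R) : R := fine (mu `]a, +oo[%classic).
Definition pos_part (a x : R) : R := Num.max (x - a) 0.
Definition excess (a : R) : R := \int[mu]_x pos_part a x.
Definition excess2 (a : R) : R := \int[mu]_x (pos_part a x ^+ 2).
(** Mean residual life, written with integrals over the whole line; [mean_overshootE] identifies it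
    with the mean overshoot. *)
Definition mrl (a : R) : R := excess a / tail a.

Definition above (a x : R) : R := (a < x)%R%:R.

Lemma aboveE a : above a = \1_(`]a, +oo[%classic).
Proof.
by apply/funext => x; rewrite indicE mem_setE in_itv /= andbT.
Qed.

Lemma integrable_above a : mu.-integrable setT (EFin \o above a).
Proof. by rewrite aboveE; exact: integrable_indic. Qed.

Lemma Rintegral_above a : \int[mu]_x above a x = tail a.
Proof. by rewrite aboveE /Rintegral integral_indic// setIT. Qed.

Lemma pos_part_ge0 a x : 0 <= pos_part a x.
Proof. by rewrite le_max lexx orbT. Qed.

Lemma pos_partE a x : pos_part a x = (x - a) * above a x.
Proof.
rewrite /pos_part /above; case: ltP => ax; rewrite ?mulr1 ?mulr0.
  by apply/max_idPl; rewrite subr_ge0 ltW.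
by apply/max_idPr; rewrite subr_le0.
Qed.

Lemma measurable_pos_part a : measurable_fun setT (pos_part a).
Proof. by apply: measurable_maxr => //; exact: measurable_funB. Qed.

Hypothesis tail_gt0 : forall a, 0 < tail a.
Hypothesis excess2_fin : exists b, (\int[mu]_x (pos_part b x ^+ 2)%:E < +oo)%E.

(** Finiteness at one level suffices, because [(x - a)_+ ^ 2 <= 2 (x - b)_+ ^ 2 + 2 (b - a) ^ 2]. *)
Lemma integrable_pos_part2 a :
  mu.-integrable setT (EFin \o (fun x => pos_part a x ^+ 2)).
Proof.
have [b b_fin] := excess2_fin.
have ib : mu.-integrable setT (EFin \o (fun x => pos_part b x ^+ 2)).
  apply/integrableP; split.
    by apply/measurable_EFinP; apply: measurable_funX; exact: measurable_pos_part.
  rewrite (le_lt_trans _ b_fin)//; under eq_integral do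
    rewrite /= ger0_norm ?sqr_ge0//.
  exact: lexx.
apply: (integrable_EFin_le _ _ _ (integrable_EFinD mu _ _
  (integrable_EFinZ mu 2 _ ib) (integrable_EFin_cst mu (2 * (b - a) ^+ 2)))).
  by apply: measurable_funX; exact: measurable_pos_part.
move=> x; rewrite ger0_norm ?sqr_ge0//.
have := sqr_ge0 (x - b - (b - a)); have := sqr_ge0 (b - a).
by rewrite /pos_part; case: (leP (x - a) 0); case: (leP (x - b) 0); nra.
Qed.

Lemma integrable_pos_part a : mu.-integrable setT (EFin \o pos_part a).
Proof.
apply: (integrable_EFin_le _ _ _ (integrable_EFinD mu _ _
  (integrable_EFin_cst mu 1) (integrable_pos_part2 a))).
  exact: measurable_pos_part.
move=> x; rewrite ger0_norm ?pos_part_ge0//.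
by have := pos_part_ge0 a x; nra.
Qed.

Lemma excess_ge0 a : 0 <= excess a.
Proof. by apply: Rintegral_ge0 => x _; exact: pos_part_ge0. Qed.

Lemma tail_le1 a : tail a <= 1.
Proof.
rewrite -lee_fin /tail fineK ?fin_num_measure//; exact: probability_le1.
Qed.

Lemma tail_ninc a b : a <= b -> tail b <= tail a.
Proof.
move=> ab; rewrite /tail fine_le ?fin_num_measure// le_measure ?inE//.
by apply: subset_itvr; rewrite bnd_simp.
Qed.

Lemma excess_ninc a b : a <= b -> excess b <= excess a.
Proof.
move=> ab; apply: le_Rintegral => //; do ?exact: integrable_pos_part.
by move=> x _; rewrite /pos_part; case: (leP (x - a) 0); case: (leP (x - b) 0); lra.
Qed.

(** Markov's inequality, from [h * above (a + h) x <= pos_part a x]. *)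
Lemma tail_le_excess a h : 0 <= h -> h * tail (a + h) <= excess a.
Proof.
move=> h0; rewrite -Rintegral_above -RintegralZl//; last exact: integrable_above.
apply: le_Rintegral => //.
- by apply: integrable_EFinZ; exact: integrable_above.
- exact: integrable_pos_part.
- by move=> x _; rewrite /above /pos_part; case: ltP => /=;
    case: (leP (x - a) 0); lra.
Qed.

Lemma excess_gt0 a : 0 < excess a.
Proof. by rewrite (lt_le_trans _ (tail_le_excess a 1 ler01))// mul1r. Qed.

Lemma mrl_gt0 a : 0 < mrl a.
Proof. by rewrite divr_gt0// excess_gt0. Qed.

Lemma measurable_tail : measurable_fun setT tail.
Proof.
by apply: nonincreasing_measurable => // a b; exact: tail_ninc.
Qed.

Lemma measurable_tailV : measurable_fun setT (fun a => (tail a)^-1).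
Proof.
apply: nondecreasing_measurable => // a b ab.
by rewrite lef_pV2 ?posrE// tail_ninc.
Qed.

Lemma measurable_mrl : measurable_fun setT mrl.
Proof.
apply: measurable_funM; last exact: measurable_tailV.
by apply: nonincreasing_measurable => // a b; exact: excess_ninc.
Qed.

(** Above [a] one has [pos_part a x <= pos_part (a + h) x + h]; square and integrate. *)
Lemma excess2_shift a h : 0 <= h ->
  excess2 a <= excess2 (a + h) + 2 * h * excess (a + h) + h ^+ 2 * tail a.
Proof.
move=> h0.
have i1 := integrable_pos_part2 (a + h).
have i2 := integrable_EFinZ mu (2 * h) _ (integrable_pos_part (a + h)).
have i3 := integrable_EFinZ mu (h ^+ 2) _ (integrable_above a).
have i12 := integrable_EFinD mu _ _ i1 i2.
rewrite -Rintegral_above -!RintegralZl//; last first.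
- exact: integrable_pos_part.
- exact: integrable_above.
rewrite -RintegralD// -RintegralD//; apply: le_Rintegral => //.
- exact: integrable_pos_part2.
- exact: integrable_EFinD.
- move=> x _; rewrite /above /pos_part.
  case: ltP => /=; case: (leP (x - a) 0); case: (leP (x - (a + h)) 0); nra.
Qed.

(** Dominated convergence: each fixed [x] is eventually below the moving level. *)
Lemma cvg_excess2 a h : 0 < h -> excess2 (a + n%:R * h) @[n --> \oo] --> 0.
Proof.
move=> h0.
have mpos2 b : measurable_fun setT (fun x => (pos_part b x ^+ 2)%:E).
  by apply/measurable_EFinP; apply: measurable_funX; exact: measurable_pos_part.
have := @dominated_convergence _ _ R mu setT measurableT
  (fun n x => (pos_part (a + n%:R * h) x ^+ 2)%:E) (cst 0%E)
  (fun x => (pos_part a x ^+ 2)%:E) (fun n => mpos2 _) (measurable_cst _).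
case=> //.
- apply/aeW => x _; apply: (cvg_near_cst _).
  exists (Num.bound `|(x - a) / h|) => // n /= xn.
  rewrite /pos_part (_ : Num.max _ _ = 0) ?expr0n//.
  apply/max_idPr; rewrite subr_le0 -lerBlDl -ler_pdivrMr//.
  apply: le_trans (ler_norm _) _; apply: ltW.
  apply: lt_le_trans (archi_boundP (normr_ge0 _)) _.
  by rewrite ler_nat.
- exact: integrable_pos_part2.
- apply/aeW => x n _; rewrite /= lee_fin ger0_norm ?sqr_ge0//.
  rewrite lerXn2r ?nnegrE ?pos_part_ge0// /pos_part.
  have := mulr_ge0 (ler0n R n) (ltW h0).
  by case: (leP (x - a) 0); case: (leP (x - (a + n%:R * h)) 0); lra.
- move=> _ _; rewrite integral0 => cv.
  exact: (fine_cvg cv).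
Qed.

(* Bounded mean overshoot forces a geometric decay of the tail. *)
Lemma excess2_le a1 (B : R) : 0 < B -> (forall a, a1 <= a -> mrl a <= B) ->
  forall a, a1 <= a -> excess2 a <= 2 * (8 * B ^+ 2) * tail a.
Proof.
move=> B0 mrlB.
have exB a : a1 <= a -> excess a <= B * tail a.
  by move=> a1a; rewrite -ler_pdivrMr//; exact: mrlB.
(* With this step length Markov's inequality halves the tail. *)
pose h := 2 * B.
have h0 : 0 < h by rewrite mulr_gt0.
have tail2 a : a1 <= a -> 2 * tail (a + h) <= tail a.
  move=> a1a; have := tail_le_excess a h (ltW h0).
  move/le_trans => /(_ _ (exB _ a1a)); rewrite /h -mulrA mulrCA.
  by rewrite ler_pM2l.
(* The two extra terms of the shift are at most [2 * B ^+ 2] and [4 * B ^+ 2] times [tail a]; the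
   constant 8 leaves room. *)
have step a : a1 <= a -> excess2 a <= excess2 (a + h) + 8 * B ^+ 2 * tail a.
  move=> a1a; apply: le_trans (excess2_shift a h (ltW h0)) _.
  have := exB (a + h) (le_trans a1a _); rewrite lerDl => /(_ (ltW h0)).
  have := tail2 a a1a; have := tail_gt0 a; have := tail_gt0 (a + h).
  rewrite /h; nra.
(* A geometric series of ratio 1/2, whence the factor 2; the remainder tends to 0 with [n]. *)
have iter n : forall a, a1 <= a ->
    excess2 a <= 2 * (8 * B ^+ 2) * tail a + excess2 (a + n%:R * h).
  elim: n => [|n IHn] a a1a.
    by rewrite mul0r addr0 lerDr !mulr_ge0// ?sqr_ge0// ltW.
  apply: le_trans (step _ a1a) _.
  have := IHn (a + h) (le_trans a1a _); rewrite lerDl => /(_ (ltW h0)).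
  rewrite (_ : a + h + n%:R * h = a + n.+1%:R * h); last first.
    by rewrite -natr1; ring.
  have := tail2 a a1a; have := sqr_ge0 B; nra.
move=> a a1a.
have := cvg_excess2 a h h0.
move=> /(cvgD (cvg_cst (2 * (8 * B ^+ 2) * tail a))); rewrite addr0 => cv.
rewrite -(cvg_lim _ cv)//; apply: limr_ge; first exact: (cvgP _ cv).
by apply: nearW => n; exact: iter.
Qed.

End overshoot.

(** * The two martingale weights *)

Section score.
Context {R : realType} (mu : probability R R).
Hypothesis tail_gt0 : forall a, 0 < tail mu a.
Hypothesis excess2_fin :
  exists b, (\int[mu]_x (pos_part b x ^+ 2)%:E < +oo)%E.

(** The overshoot centred by its conditional mean. It is set to zero for [a < a1], as the variance
    bound is established only from [a1] on. *)
Definition score (a1 a x : R) : R :=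
  if (a1 <= a) && (a < x) then x - a - mrl mu a else 0.

(** Centred indicator of a selection beyond [a1 + 1]: the quotient is the conditional probability of
    that event given [X > a]. It drives the averages past [a1]. *)
Definition jump_score (a1 a x : R) : R :=
  if (a < a1) && (a < x) then above (a1 + 1) x - tail mu (a1 + 1) / tail mu a
  else 0.

Lemma score_supp a1 a x : x <= a -> score a1 a x = 0.
Proof. by move=> xa; rewrite /score ltNge xa andbF. Qed.

Lemma jump_score_supp a1 a x : x <= a -> jump_score a1 a x = 0.
Proof. by move=> xa; rewrite /jump_score [a < x]ltNge xa andbF. Qed.

Lemma measurable_above2 (f g : R * R -> R) :
  measurable_fun setT f -> measurable_fun setT g ->
  measurable_fun setT (fun z => above (f z) (g z)).
Proof.
move=> mf mg; have := measurable_fun_ltr mf mg => mfg.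
by apply: (measurableT_comp (f := fun b : bool => b%:R : R)).
Qed.

Lemma measurable_score a1 : measurable_fun setT (fun z => score a1 z.1 z.2).
Proof.
apply: measurable_fun_ifT => //.
  apply: measurable_and; first by apply: measurable_fun_ler.
  exact: (measurable_fun_ltr measurable_fst measurable_snd).
apply: measurable_funB; first by apply: measurable_funB.
by apply: (@measurableT_comp _ _ _ _ _ _ (mrl mu)) => //; exact: measurable_mrl.
Qed.

Lemma measurable_jump_score a1 :
  measurable_fun setT (fun z => jump_score a1 z.1 z.2).
Proof.
apply: measurable_fun_ifT => //.
  apply: measurable_and; first by apply: measurable_fun_ltr.
  exact: (measurable_fun_ltr measurable_fst measurable_snd).
apply: measurable_funB; first exact: measurable_above2.
apply: measurable_funM => //.
apply: (@measurableT_comp _ _ _ _ _ _ (fun a => (tail mu a)^-1)) => //.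
exact: measurable_tailV.
Qed.

Lemma scoreE a1 a : a1 <= a ->
  score a1 a = (fun x => pos_part a x + (- mrl mu a) * above a x).
Proof.
move=> a1a; apply/funext => x; rewrite /score a1a /= pos_partE /above.
by case: ltP => _ /=; ring.
Qed.

Lemma score0 a1 a : a < a1 -> score a1 a = fun=> 0.
Proof. by move=> aa1; apply/funext => x; rewrite /score leNgt aa1. Qed.

Lemma score2E a1 a : a1 <= a -> (fun x => score a1 a x ^+ 2) =
  (fun x => (pos_part a x ^+ 2 + (- (2 * mrl mu a)) * pos_part a x) +
     mrl mu a ^+ 2 * above a x).
Proof.
move=> a1a; apply/funext => x; rewrite scoreE// pos_partE /above.
by case: ltP => _ /=; ring.
Qed.

Lemma integrable_score a1 a : mu.-integrable setT (EFin \o score a1 a).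
Proof.
have [a1a|aa1] := leP a1 a; last first.
  by rewrite score0//; exact: integrable_EFin_cst.
rewrite scoreE//; apply: integrable_EFinD; first exact: integrable_pos_part.
by apply: integrable_EFinZ; exact: integrable_above.
Qed.

Lemma integrable_score2 a1 a :
  mu.-integrable setT (EFin \o (fun x => score a1 a x ^+ 2)).
Proof.
have [a1a|aa1] := leP a1 a; last first.
  by rewrite score0// expr0n; exact: integrable_EFin_cst.
rewrite score2E//; apply: integrable_EFinD; last first.
  by apply: integrable_EFinZ; exact: integrable_above.
apply: integrable_EFinD; first exact: integrable_pos_part2.
by apply: integrable_EFinZ; exact: integrable_pos_part.
Qed.

Lemma score_mean a1 a : \int[mu]_x score a1 a x = 0.
Proof.
have [a1a|aa1] := leP a1 a; last first.
  by rewrite score0// Rintegral_cst// mul0r.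
rewrite scoreE// RintegralD//; last 2 first.
- exact: integrable_pos_part.
- by apply: integrable_EFinZ; exact: integrable_above.
rewrite RintegralZl//; last exact: integrable_above.
by rewrite Rintegral_above mulNr divfK ?subrr// gt_eqF.
Qed.

(** Centring only lowers the second moment: from [a1] on the integral equals
    [excess2 mu a - mrl mu a ^+ 2 * tail mu a]. *)
Lemma score_var a1 (C : R) : 0 <= C ->
  (forall a, a1 <= a -> excess2 mu a <= C * tail mu a) ->
  forall a, \int[mu]_x (score a1 a x ^+ 2) <= C * fine (mu `]a, +oo[%classic).
Proof.
move=> C0 excess2C a; have [a1a|aa1] := leP a1 a; last first.
  by rewrite score0// expr0n Rintegral_cst// mul0r mulr_ge0// fine_ge0.
have i1 := integrable_pos_part2 mu excess2_fin a.
have i2 := integrable_EFinZ mu (- (2 * mrl mu a)) _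
  (integrable_pos_part mu excess2_fin a).
have i3 := integrable_EFinZ mu (mrl mu a ^+ 2) _ (integrable_above mu a).
rewrite score2E// RintegralD//; last exact: integrable_EFinD.
rewrite RintegralD// !RintegralZl//;
  do ?[exact: integrable_above|exact: integrable_pos_part].
rewrite Rintegral_above -/(excess2 mu a) -/(excess mu a).
apply: le_trans (excess2C _ a1a).
have -> : excess mu a = mrl mu a * tail mu a by rewrite divfK// gt_eqF.
have := mulr_ge0 (sqr_ge0 (mrl mu a)) (ltW (tail_gt0 a)).
nra.
Qed.

Lemma jump_scoreE a1 a : a < a1 -> jump_score a1 a =
  (fun x => above (a1 + 1) x + (- (tail mu (a1 + 1) / tail mu a)) * above a x).
Proof.
move=> aa1; apply/funext => x; rewrite /jump_score aa1 /above /=.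
by case: (ltP a x) => ?; case: ltP => ? /=; lra.
Qed.

Lemma jump_score0 a1 a : a1 <= a -> jump_score a1 a = fun=> 0.
Proof. by move=> a1a; apply/funext => x; rewrite /jump_score ltNge a1a. Qed.

Lemma integrable_jump_score a1 a : mu.-integrable setT (EFin \o jump_score a1 a).
Proof.
have [a1a|aa1] := leP a1 a.
  by rewrite jump_score0//; exact: integrable_EFin_cst.
rewrite jump_scoreE//; apply: integrable_EFinD; first exact: integrable_above.
by apply: integrable_EFinZ; exact: integrable_above.
Qed.

Lemma jump_score_mean a1 a : \int[mu]_x jump_score a1 a x = 0.
Proof.
have [a1a|aa1] := leP a1 a.
  by rewrite jump_score0// Rintegral_cst// mul0r.
rewrite jump_scoreE// RintegralD//; last 2 first.
- exact: integrable_above.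
- by apply: integrable_EFinZ; exact: integrable_above.
rewrite RintegralZl//; last exact: integrable_above.
by rewrite !Rintegral_above mulNr divfK ?subrr// gt_eqF.
Qed.

(** The quotient of tails lies in [[0, 1]] when [a < a1], so the score has modulus at most 1. *)
Lemma jump_score2_le a1 a x : jump_score a1 a x ^+ 2 <= above a x.
Proof.
rewrite /jump_score; have [aa1|] := ltP a a1; last first.
  by rewrite expr0n; case: ltP.
rewrite /above /=; case: (ltP a x) => /= ax; last by rewrite expr0n.
have q0 : 0 <= tail mu (a1 + 1) / tail mu a by rewrite divr_ge0// ltW.
have q1 : tail mu (a1 + 1) / tail mu a <= 1.
  by rewrite ler_pdivrMr// mul1r tail_ninc//; lra.
by case: ltP => _ /=; nra.
Qed.

Lemma integrable_jump_score2 a1 a :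
  mu.-integrable setT (EFin \o (fun x => jump_score a1 a x ^+ 2)).
Proof.
apply: integrable_EFin_le (integrable_above mu a) _.
  apply: measurable_funX.
  by have /measurable_EFinP := measurable_int _ (integrable_jump_score a1 a).
by move=> x; rewrite ger0_norm ?sqr_ge0// jump_score2_le.
Qed.

Lemma jump_score_var a1 a :
  \int[mu]_x (jump_score a1 a x ^+ 2) <= 1 * fine (mu `]a, +oo[%classic).
Proof.
rewrite mul1r -/(tail mu a) -Rintegral_above; apply: le_Rintegral => //.
- exact: integrable_jump_score2.
- exact: integrable_above.
- by move=> x _; exact: jump_score2_le.
Qed.

End score.

(** * Deterministic recursions *)

Section deterministic.
Context {R : realType}.
Implicit Types (D E a N g : nat -> R) (f : R -> R).

Lemma nonincreasing_tail_cvgn (u : nat -> R) (N : nat) (M : R) :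
  (forall n, (N <= n)%N -> u n.+1 <= u n) ->
  (forall n, (N <= n)%N -> M <= u n) -> cvgn u.
Proof.
move=> u_ninc u_lb.
have /cvg_ex[/= l] : cvgn (fun n => u (n + N)%N).
  apply: nonincreasing_is_cvgn.
    by apply/nonincreasing_seqP => n; rewrite addSn; apply: u_ninc; rewrite leq_addl.
  by exists M => _ [n _ <-]; apply: u_lb; rewrite leq_addl.
by rewrite (cvg_shiftn N u (nbhs l)) => ul; apply/cvg_ex; exists l.
Qed.

(** Truncate at a small positive level instead of 0. Where [E] exceeds half that level, [D] is
    nonnegative and [E] does not increase; elsewhere one small increment cannot pass the level. So
    the truncated sequence is eventually nonincreasing. *)
Lemma drift_max_cvg D E :
  E n - D n @[n --> \oo] --> 0 ->
  E n.+1 - E n @[n --> \oo] --> 0 ->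
  (\forall n \near \oo, 0 <= D n -> E n.+1 <= E n) ->
  cvgn (fun n => Num.max (E n) 0).
Proof.
move=> /cvgrPdist_lt DD /cvgrPdist_lt dD [N1 _ drift].
apply: cauchy_tail_cvgn => e e0.
(* Truncating at [2 * (e / 5)] costs at most that much, and closeness to the limit costs another
   [2 * (e / 5)], in all less than [e]. *)
have e5 : 0 < e / 5 by rewrite divr_gt0.
have [N2 _ DDe] := DD _ e5.
have [N3 _ dDe] := dD _ e5.
pose N := (N1 + N2 + N3)%N.
have u_cvg : cvgn (fun n => Num.max (E n) (2 * (e / 5))).
  apply: (nonincreasing_tail_cvgn _ N (2 * (e / 5))) => n Nn; last first.
    by rewrite le_max lexx orbT.
  have := DDe n; have := dDe n; have := drift n.
  rewrite /= !sub0r !normrN => H1 H2 H3.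
  have {}H1 := H1 (leq_trans (leq_trans (leq_addr _ _) (leq_addr _ _)) Nn).
  have := H2 (leq_trans (leq_addl _ _) Nn).
  have := H3 (leq_trans (leq_trans (leq_addl _ _) (leq_addr _ _)) Nn).
  rewrite !ltr_norml => /andP[_ D1] /andP[_ D2].
  have [Ee|Ee] := ltP (e / 5) (E n).
    have /H1 D3 : 0 <= D n by lra.
    by rewrite ge_max !le_max D3 lexx orbT.
  by rewrite ge_max !le_max lexx orbT andbT; apply/orP; right; lra.
have /cvg_ex[/= l /cvgrPdist_lt/(_ _ e5)[N4 _ ul]] := u_cvg.
exists N4 => n N4n; have := ul n N4n; have := ul N4 (leqnn _).
rewrite /= !ltr_norml => /andP[u1 u2] /andP[u3 u4].
move: u1 u2 u3 u4.
case: (leP (E n) 0); case: (leP (E N4) 0); case: (leP (E n) (2 * (e / 5)));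
  case: (leP (E N4) (2 * (e / 5))) => *; apply/andP; split; lra.
Qed.

(** The hypotheses are symmetric under a change of sign, so the positive and the negative part of
    [E] both converge, and [D] differs from [E] by a null sequence. *)
Lemma drift_cvg D E :
  E n - D n @[n --> \oo] --> 0 ->
  E n.+1 - E n @[n --> \oo] --> 0 ->
  (\forall n \near \oo, 0 <= D n -> E n.+1 <= E n) ->
  (\forall n \near \oo, D n <= 0 -> E n <= E n.+1) ->
  cvgn D.
Proof.
move=> DD dD dn up.
have cmax := drift_max_cvg D E DD dD dn.
have cmin : cvgn (fun n => Num.max (- E n) 0).
  apply: (drift_max_cvg (fun n => - D n) (fun n => - E n)).
  - by rewrite -oppr0; under eq_fun do rewrite -opprD; exact: cvgN.
  - by rewrite -oppr0; under eq_fun do rewrite -opprD; exact: cvgN.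
  - by apply: filterS up => n upn; rewrite oppr_ge0 lerN2.
have -> : D = (fun n => (Num.max (E n) 0 - Num.max (- E n) 0) - (E n - D n)).
  apply/funext => n.
  by case: (leP (E n) 0); case: (leP (- E n) 0); lra.
apply: is_cvgB; first exact: is_cvgB.
by apply/cvg_ex; exists 0.
Qed.

(** [K], [a] and [N] stand for count, average and martingale in real time; each step either fixes
    all three or is a selection. Both [a] and [g] follow the drift [f / (k + 1)] up to convergent
    terms, and since [f] is nonincreasing the larger of the two drifts no faster. *)
Lemma coupled_cvg f (a1 B : R) a N (K : nat -> nat) g :
  (forall u v, a1 <= u -> u <= v -> f v <= f u) ->
  (forall u, a1 <= u -> 0 <= f u <= B) ->
  (\forall n \near \oo, a1 <= a n) ->
  (forall n, (K n.+1 = K n /\ a n.+1 = a n /\ N n.+1 = N n) \/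
    (K n.+1 = (K n).+1 /\
     (a1 <= a n -> a n.+1 = a n + f (a n) / (K n).+1%:R + (N n.+1 - N n)))) ->
  cvgn N ->
  (forall k, \forall n \near \oo, (k <= K n)%N) ->
  (\forall k \near \oo, a1 <= g k) ->
  cvgn (fun k => g k - \sum_(i < k) f (g i) / i.+1%:R) ->
  cvgn (fun n => a n - g (K n)).
Proof.
move=> f_ninc f_bnd a_ge step /cvg_ex[/= lN NlN] Koo g_ge /cvg_ex[/= lH HlH].
pose S k := \sum_(i < k) f (g i) / i.+1%:R.
have gK_ge : \forall n \near \oo, a1 <= g (K n).
  by case: g_ge => k1 _ g_ge; apply: filterS (Koo k1) => n; exact: g_ge.
(* Taking the martingale out of [a] and replacing [g] by its sum of drifts leaves pure drift; the
   constant makes the difference from [a n - g (K n)] tend to 0. *)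
pose E n := (a n - N n) - S (K n) + (lN - lH).
have dE n : a1 <= a n -> E n.+1 - E n = 0 \/
    E n.+1 - E n = (f (a n) - f (g (K n))) / (K n).+1%:R.
  move=> an; rewrite /E; case: (step n) => [[-> [-> ->]]|[-> /(_ an) ->]].
    by left; rewrite subrr.
  right; have -> : S (K n).+1 = S (K n) + f (g (K n)) / (K n).+1%:R.
    by rewrite /S big_ord_recr.
  by rewrite mulrBl; ring.
have K1_gt0 n : 0 < (K n).+1%:R^-1 :> R by rewrite invr_gt0.
apply: (drift_cvg _ E).
- have -> : (fun n => E n - (a n - g (K n))) =
      (fun n => (lN - N n) - (lH - (g (K n) - S (K n)))).
    by apply/funext => n; rewrite /E; lra.
  rewrite -[X in _ --> X](subrr 0); apply: cvgB.
    by rewrite -(subrr lN); apply: cvgB => //; exact: cvg_cst.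
  rewrite -(subrr lH); apply: cvgB; first exact: cvg_cst.
  apply: (cvg_comp K (fun k => g k - S k) _ HlH).
  by move=> U [k0 _ k0U]; apply: filterS (Koo k0) => n; exact: k0U.
- apply/cvgrPdist_lt => e e0.
  have Be : 0 < (B + 1) / e.
    rewrite divr_gt0//; case: a_ge => n0 _ /(_ n0 (leqnn _)) an0.
    by have /andP[] := f_bnd _ an0; lra.
  apply: filterS3 a_ge gK_ge (Koo (Num.bound ((B + 1) / e))) => n an gn Kn.
  rewrite sub0r normrN; case: (dE n an) => ->; first by rewrite normr0.
  rewrite normrM [X in _ * X]gtr0_norm// ltr_pdivrMr//.
  have := archi_boundP (ltW Be); rewrite ltr_pdivrMr// => Bb.
  have : (Num.bound ((B + 1) / e))%:R * e <= (K n).+1%:R * e.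
    by rewrite ler_wpM2r ?(ltW e0)// ler_nat leqW.
  have /andP[fa0 faB] := f_bnd _ an; have /andP[fg0 fgB] := f_bnd _ gn.
  by move=> Ke; rewrite ltr_norml; apply/andP; split; lra.
- apply: filterS2 a_ge gK_ge => n an gn; rewrite subr_ge0 => ga.
  rewrite -subr_le0; case: (dE n an) => -> //.
  by rewrite pmulr_lle0// subr_le0 f_ninc.
- apply: filterS2 a_ge gK_ge => n an gn; rewrite subr_le0 => ag.
  rewrite -subr_ge0; case: (dE n an) => -> //.
  by rewrite pmulr_lge0// subr_ge0 f_ninc.
Qed.

End deterministic.

(** * The inverse of [G] along the logarithms *)

Section clamp.
Context {R : realType}.
Implicit Types a b x y : R.

(** Projection onto [[a, b]], used to extend a function from the interval to one continuous on the
    whole line. *)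
Definition clamp a b x := Num.max a (Num.min x b).

Lemma clamp_id a b x : a <= x -> x <= b -> clamp a b x = x.
Proof. by move=> ax xb; rewrite /clamp (min_idPl xb) (max_idPr ax). Qed.

Lemma clamp_bnd a b x y : a <= b -> x <= y ->
  [/\ a <= clamp a b x, clamp a b x <= clamp a b y, clamp a b y <= b &
      clamp a b y - clamp a b x <= y - x].
Proof.
rewrite /clamp => ab xy; case: (leP x b); case: (leP y b); case: (leP a x);
  case: (leP a y); case: (leP a b) => *; split; lra.
Qed.

End clamp.

Section log_increments.
Context {R : realType}.

Lemma ln_incr_le (k : nat) : (0 < k)%N -> ln k.+1%:R - ln k%:R <= k%:R^-1 :> R.
Proof.
move=> k0; have k0' : 0 < k%:R :> R by rewrite ltr0n.
rewrite -ln_div ?posrE//.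
have -> : k.+1%:R / k%:R = 1 + k%:R^-1 :> R
  by rewrite -natr1 mulrDl divff ?gt_eqF// mul1r.
by apply: le_ln1Dx; rewrite (lt_trans (ltrN10 _))// invr_gt0.
Qed.

Lemma ln_incr_ge (k : nat) : (0 < k)%N -> k.+1%:R^-1 <= ln k.+1%:R - ln k%:R :> R.
Proof.
move=> k0; have k0' : 0 < k%:R :> R by rewrite ltr0n.
rewrite -[leRHS]opprB -ln_div ?posrE// lerNr.
have -> : k%:R / k.+1%:R = 1 + - k.+1%:R^-1 :> R.
  by rewrite -natr1; field; rewrite natr1 pnatr_eq0.
apply: le_ln1Dx; rewrite ltrN2 invf_lt1// ltr1n ltnS//.
Qed.

Lemma ln_le_harmonic (k : nat) : ln k.+1%:R <= \sum_(i < k) i.+1%:R^-1 :> R.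
Proof.
elim: k => [|k IHk]; first by rewrite big_ord0 ln1.
rewrite big_ord_recr /=; have := ln_incr_le k.+1 isT.
by rewrite lerBlDr => /le_trans; apply; rewrite addrC lerD2l.
Qed.

Lemma near_ln_gt (M : R) : \forall k \near \oo, M < ln k%:R.
Proof.
exists (Num.bound (expR M)) => // k /= Mk.
rewrite -[ltLHS]expRK ltr_ln ?posrE ?expR_gt0//.
  by apply: lt_le_trans (archi_boundP (expR_ge0 _)) _; rewrite ler_nat.
rewrite (lt_le_trans (expR_gt0 M))// ltW//.
by apply: lt_le_trans (archi_boundP (expR_ge0 _)) _; rewrite ler_nat.
Qed.

End log_increments.

Section increasing_primitive.
Context {R : realType}.
Variables (f G : R -> R) (x0 a1 B : R).
Hypotheses (x0a1 : x0 < a1) (f_gt0 : forall u, 0 < f u)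
  (f_ninc : forall u v, a1 <= u -> u <= v -> f v <= f u)
  (G_nd : forall x y, x0 < x -> x <= y -> G x <= G y)
  (G_incr_bnd : forall x y, a1 <= x -> x <= y ->
    (y - x) / f x <= G y - G x <= (y - x) / f y).

Lemma increasing_surj v : G a1 < v -> exists2 x, a1 <= x & G x = v.
Proof.
(* From [a1] to [b] the slope of [G] is at least [1 / f a1], so [G] has reached [v] at [b]. *)
move=> a1v; pose b := a1 + (v - G a1) * f a1.
have a1b : a1 <= b by rewrite lerDl mulr_ge0 ?subr_ge0 ?ltW.
have Gb : v <= G b.
  have /andP[+ _] := G_incr_bnd _ _ (lexx a1) a1b.
  have -> : (b - a1) / f a1 = v - G a1 by rewrite /b addrC addKr mulfK// gt_eqF.
  by rewrite lerD2r.
(* On [[a1, b]] the slope of [G] is at most [1 / f b]; composition with the projection gives a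
   function that is Lipschitz on the whole line. *)
have cG : {within `[a1, b], continuous G}.
  pose clamp := clamp a1 b.
  have clampE x : x \in `[a1, b]%classic -> (G \o clamp) x = G x.
    by rewrite inE /= in_itv /= => /andP[a1x xb]; rewrite /clamp clamp_id.
  apply: (@subspace_eq_continuous _ _ _ (G \o clamp)); first exact: clampE.
  apply: continuous_subspaceT => x; apply/cvgrPdist_lt => e e0.
  have Lip y z : y <= z -> `|G (clamp y) - G (clamp z)| <= `|y - z| / f b.
    move=> yz.
    have [a1y cyz czb dcl] := clamp_bnd _ _ _ _ a1b yz.
    rewrite distrC ger0_norm; last first.
      by rewrite subr_ge0 G_nd// (lt_le_trans x0a1).
    have /andP[_ /le_trans] := G_incr_bnd _ _ a1y cyz; apply.
    rewrite distrC ger0_norm ?subr_ge0//.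
    apply: ler_pM => //; rewrite ?subr_ge0// ?invr_ge0 ?(ltW (f_gt0 _))//.
    by rewrite lef_pV2 ?posrE// f_ninc// (le_trans a1y).
  have d0 : 0 < e * f b by rewrite mulr_gt0.
  near=> y.
  have xy : `|x - y| < e * f b by near: y; exact: cvgr_dist_lt.
  rewrite -ltr_pdivrMr// in xy; apply: le_lt_trans xy.
  have [xy|/ltW yx] := leP x y; first exact: Lip.
  by rewrite distrC [in leRHS]distrC; exact: Lip.
have [|x] := @IVT _ G a1 b v a1b cG.
  by rewrite ge_min le_max (ltW a1v) Gb orbT.
by rewrite in_itv /= => /andP[a1x _] Gx; exists x.
Unshelve. all: by end_near. Qed.

Let g (k : nat) := pinv `]x0, +oo[ G (ln k%:R).

(** Surjectivity makes [pinv] a right inverse at [ln k], whichever preimage it picks. That preimage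
    cannot lie below [a1], where [G] is at most [G a1]. *)
Let gP k : G a1 < ln k%:R -> a1 <= g k /\ G (g k) = ln k%:R.
Proof.
move=> Gk; have [x a1x Gx] := increasing_surj _ Gk.
have img : (G @` `]x0, +oo[) (ln k%:R).
  by exists x => //=; rewrite in_itv /= andbT (lt_le_trans x0a1).
have GgE : G (g k) = ln k%:R by apply: pinvK; rewrite inE.
split=> //; rewrite leNgt; apply/negP => ga1.
have gx0 : x0 < g k.
  have /= : `]x0, +oo[%classic (g k); last by rewrite in_itv /= andbT.
  by apply: (@surjpinv_image_sub _ _ _ _ (G @` `]x0, +oo[%classic) G) => //;
    exists (ln k%:R).
by have := G_nd _ _ gx0 (ltW ga1); rewrite GgE leNgt Gk.
Qed.

Lemma near_pinv_ge : \forall k \near \oo, a1 <= g k.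
Proof. by apply: filterS (near_ln_gt (G a1)) => k /gP[]. Qed.

(* By monotonicity of f each error g_(k+1) - g_k - f(g_k)/(k+1) lies between
   f(g_(k+1)) - f(g_k) and B/k - B/(k+1), so the errors are summable. *)
Lemma cvg_pinv_sum : (forall u, a1 <= u -> f u <= B) ->
  cvgn (fun k => g k - \sum_(i < k) f (g i) / i.+1%:R).
Proof.
move=> fB.
have [N _ GN] := near_ln_gt (G a1).
pose H k := g k - \sum_(i < k) f (g i) / i.+1%:R.
have HS k : H k.+1 - H k = g k.+1 - g k - f (g k) / k.+1%:R.
  by rewrite /H big_ord_recr /=; ring.
have B0 : 0 <= B by rewrite (le_trans _ (fB a1 (lexx _)))// ltW.
have stepP k : (N.+1 <= k)%N ->
    f (g k.+1) - f (g k) <= H k.+1 - H k <= B / k%:R - B / k.+1%:R.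
  move=> Nk; have k0 : (0 < k)%N by apply: leq_trans Nk.
  have [a1k Gk] := gP _ (GN _ (ltnW Nk)).
  have [a1k1 Gk1] := gP _ (GN k.+1 (leqW (ltnW Nk))).
  have gk : g k <= g k.+1.
    rewrite leNgt; apply/negP => /ltW/G_nd.
    rewrite (lt_le_trans x0a1)// => /(_ isT).
    by rewrite Gk Gk1 ler_ln ?posrE ?ltr0n// ler_nat ltnn.
  have := G_incr_bnd _ _ a1k gk; rewrite Gk Gk1 => /andP[].
  rewrite ler_pdivrMr// => ub; rewrite ler_pdivlMr// => lb.
  rewrite HS; have := @ln_incr_le R k k0; have := @ln_incr_ge R k k0.
  set L := ln _ - ln _ in ub lb *; move=> Lge Lle.
  have fk := fB _ a1k; have fk0 := f_gt0 (g k); have fk10 := f_gt0 (g k.+1).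
  have fmono := f_ninc _ _ a1k gk.
  have k1V0 : 0 < k.+1%:R^-1 :> R by rewrite invr_gt0.
  have k1V1 : k.+1%:R^-1 <= 1 :> R by rewrite invf_le1// ler1n.
  set c := k.+1%:R^-1 in Lge k1V0 k1V1 *; set c' := k%:R^-1 in Lle *.
  (* The increment of [g] lies between [L * f (g k.+1)] and [L * f (g k)]. The lower bound then uses
     [c <= L] and [c <= 1], the upper one [L <= c'] and [f (g k) <= B]. *)
  apply/andP; split.
    have p1 : 0 <= (L - c) * f (g k.+1) by rewrite mulr_ge0 ?subr_ge0// ltW.
    have p2 : 0 <= (1 - c) * (f (g k) - f (g k.+1)) by rewrite mulr_ge0 ?subr_ge0.
    by move: p1 p2 lb; clearbody L c; lra.
  have p1 : 0 <= (c' - L) * f (g k) by rewrite mulr_ge0 ?subr_ge0// ltW.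
  have p2 : 0 <= (c' - c) * (B - f (g k)).
    by rewrite mulr_ge0 ?subr_ge0// (le_trans Lge).
  by move: p1 p2 ub; clearbody L c c'; lra.
(* Adding [B / k] turns the upper bounds into monotonicity; telescoping the lower ones bounds the
   sequence from below. *)
have : cvgn (fun k => H k + B / k%:R).
  apply: (nonincreasing_tail_cvgn _ N.+1 (H N.+1 - f (g N.+1))) => k Nk.
    have /andP[_] := stepP k Nk; move: (B / k.+1%:R) (B / k%:R) => u v; lra.
  have mono : H N.+1 - f (g N.+1) <= H k - f (g k).
    rewrite -(subnK Nk); elim: (k - N.+1)%N => // m IHm.
    have /andP[+ _] := stepP (m + N.+1)%N (leq_addl _ _).
    by rewrite addSn; lra.
  have := f_gt0 (g k); have : 0 <= B / k%:R by rewrite divr_ge0.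
  by move: (B / k%:R) => u; lra.
move=> cvgHB.
have -> : (fun k => g k - \sum_(i < k) f (g i) / i.+1%:R) =
    (fun k => (H k + B / k%:R) - B / k%:R).
  by apply/funext => k; rewrite addrK.
apply: is_cvgB => //; apply/cvg_ex; exists (B * 0).
apply: cvgM; first exact: cvg_cst.
by rewrite -(cvg_shiftS (fun k => k%:R^-1 : R)); exact: cvg_harmonic.
Qed.

End increasing_primitive.

(** * [G_fun] as a primitive of [1 / f] *)

Section inverse_hazard.
Context {R : realType}.
Variables (f : R -> R) (x0 r a1 : R).
Hypotheses (r_gt0 : 0 < r) (x0a1 : x0 < a1) (f_gt0 : forall u, 0 < f u)
  (mfV : measurable_fun setT (fun u => (f u)^-1))
  (fV_bnd : forall y, exists M, forall u, u <= y -> (f u)^-1 <= M)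
  (f_ninc : forall u v, a1 <= u -> u <= v -> f v <= f u).

Let leb := @lebesgue_measure R.
Let G := G_fun f x0 r.

(** [1 / f] is bounded on every left ray, so it is integrable down to the endpoint [x0] as well. *)
Let fV_int (a b : itv_bound R) (x y : R) : [set` Interval a b] `<=` `[x, y] ->
  leb.-integrable [set` Interval a b] (EFin \o (fun u => (f u)^-1)).
Proof.
move=> ab_xy; have [M fVM] := fV_bnd y.
apply: (@integrableS _ _ R leb `[x, y]%classic) => //.
apply: measurable_bounded_integrable => //.
- by rewrite /= lebesgue_measure_itv/=; case: ifP; rewrite -?EFinD ltry.
- exact: measurable_funS mfV.
- exists M; split; rewrite ?num_real// => N MN u /=.
  rewrite in_itv /= => /andP[_ uy].
  rewrite gtr0_norm ?invr_gt0//; apply: le_trans (ltW MN).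
  exact: fVM.
Qed.

Let GE x : G x = - ln r + \int[leb]_(u in `]x0, x[) (f u)^-1.
Proof. by rewrite /G /G_fun lnM ?posrE ?expR_gt0// expRK opprD opprK. Qed.

Let G_incr x y : x0 < x -> x <= y -> G y - G x = \int[leb]_(u in `[x, y[) (f u)^-1.
Proof.
move=> x0x xy.
have xy' : `]x0, y[%classic = `]x0, x[%classic `|` `[x, y[%classic :> set R.
  by rewrite -itv_bndbnd_setU// bnd_simp.
rewrite !GE opprD addrACA subrr add0r xy' Rintegral_setU//.
- by rewrite addrC addKr.
- rewrite -xy'; apply: (fV_int _ _ x0 y); apply: subset_itv; by rewrite bnd_simp.
- rewrite disj_set2E; apply/eqP/seteqP; split=> // u /= [].
  by rewrite !in_itv /= => /andP[_ ux] /andP[xu _];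
    have := le_lt_trans xu ux; rewrite ltxx.
Qed.

Let leb_itv x y : x <= y -> fine (leb `[x, y[) = y - x.
Proof.
move=> xy; rewrite /leb lebesgue_measure_itv/= lte_fin.
by case: ltP => //= yx; apply/esym/eqP; rewrite subr_eq0 eq_le yx xy.
Qed.

Lemma G_fun_nd x y : x0 < x -> x <= y -> G x <= G y.
Proof.
move=> x0x xy; rewrite -subr_ge0 G_incr//; apply: Rintegral_ge0 => u _.
by rewrite invr_ge0 ltW.
Qed.

(** [1 / f] is nondecreasing from [a1] on, so its integral over [[x, y[] lies between the length
    times its values at the endpoints. *)
Lemma G_fun_incr_bnd x y : a1 <= x -> x <= y ->
  (y - x) / f x <= G y - G x <= (y - x) / f y.
Proof.
move=> a1x xy; rewrite G_incr ?(lt_le_trans x0a1)//.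
have i1 : leb.-integrable `[x, y[ (EFin \o (fun u => (f u)^-1)).
  by apply: (fV_int _ _ x y); apply: subset_itv; rewrite bnd_simp.
have i2 (c : R) : leb.-integrable `[x, y[ (EFin \o (fun=> c)).
  apply: measurable_bounded_integrable => //.
    by rewrite /= lebesgue_measure_itv/=; case: ifP; rewrite -?EFinD ltry.
  by exists `|c|; split; rewrite ?num_real// => N cN u _; exact: ltW.
rewrite -(leb_itv _ _ xy) ![_ * (f _)^-1]mulrC -!Rintegral_cst//.
apply/andP; split; apply: le_Rintegral => // u /=;
  rewrite in_itv /= => /andP[xu uy].
  by rewrite lef_pV2 ?posrE// f_ninc.
by rewrite lef_pV2 ?posrE// f_ninc ?(le_trans a1x)// ltW.
Qed.

End inverse_hazard.
(** * The limit of the averages *)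

(** The rays []x, +oo[] form a pi-system that generates the Borel sets. *)
Lemma eq_law_cdf {R : realType} {d} {T : measurableType d} (P : probability T R)
    (X Y : {RV P >-> R}) :
  (forall x, cdf X x = cdf Y x) ->
  forall B, measurable B -> P (X @^-1` B) = P (Y @^-1` B).
Proof.
move=> XY B mB.
rewrite -[LHS]/(distribution P X B) -[RHS]/(distribution P Y B).
apply: (measure_unique (@RGenOInfty.G R)
  (fun k => `]- k%:R, +oo[%classic : set R)) => //.
- exact: RGenOInfty.measurableE.
- move=> _ _ [x ->] [y ->]; exists (Num.max x y).
  apply/seteqP; split=> u /=; rewrite !in_itv /= !andbT gt_max.
    by case=> -> ->.
  by move=> /andP[].
- by move=> k; exists (- k%:R).
- apply/seteqP; split=> // u _; exists (Num.bound `|u|) => //=.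
  rewrite in_itv /= andbT ltrNl (le_lt_trans (ler_norm _))// normrN.
  exact: archi_boundP.
- by move=> _ [x ->]; rewrite -[LHS]/(ccdf X x) -[RHS]/(ccdf Y x) !ccdf_1_cdf XY.
- by move=> k; rewrite (le_lt_trans (probability_le1 _ _))// ltry.
Qed.

Section overshoot_moments.
Context {R : realType} {d} {T : measurableType d} (P : probability T R)
  (X : {RV P >-> R}).
Let mu : probability R R := distribution P X.

(** A positive power turns the restriction to [X > a] into the positive part, since [0 ^+ n = 0]. *)
Lemma overshoot_momentE n a : (0 < n)%N -> overshoot_moment X n a =
  ((\int[mu]_x (pos_part a x ^+ n)%:E) * ((tail mu a)^-1)%:E)%E.
Proof.
move=> n0; rewrite /overshoot_moment /expectation_given.
have -> : P [set w | a < X w] = mu `]a, +oo[%classic.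
  by rewrite /mu /distribution /pushforward /=; congr (P _); apply/seteqP;
    split=> w /=; rewrite in_itv /= andbT.
congr (_ * _)%E.
rewrite (ge0_integral_distribution X)//; last 2 first.
- by apply/measurable_EFinP; apply: measurable_funX; exact: measurable_pos_part.
- by move=> y; rewrite lee_fin exprn_ge0// pos_part_ge0.
rewrite integral_mkcond; apply: eq_integral => w _ /=.
rewrite patchE pos_partE /above; case: ltP => /= ax.
  by rewrite mem_set// mulr1.
by rewrite memNset /= ?mulr0 ?expr0n ?gtn_eqF//; apply/negP; rewrite -leNgt.
Qed.

Hypothesis tail_gt0 : forall a, 0 < tail mu a.

Lemma excess2_fin_of_moment a : (overshoot_moment X 2 a < +oo)%E ->
  (\int[mu]_x (pos_part a x ^+ 2)%:E < +oo)%E.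
Proof.
rewrite overshoot_momentE// => fin.
rewrite ltNge leye_eq; apply/negP => /eqP int_oo.
by move: fin; rewrite int_oo gt0_mulye ?ltxx// lte_fin invr_gt0.
Qed.

Lemma mean_overshootE :
  (exists b, (\int[mu]_x (pos_part b x ^+ 2)%:E < +oo)%E) ->
  mean_overshoot X = mrl mu.
Proof.
move=> fin2; apply/funext => a; rewrite /mean_overshoot overshoot_momentE//.
have ie := integrable_pos_part mu fin2 a.
under eq_integral do rewrite expr1.
by rewrite fineM//; exact: (integrable_fin_num _ ie).
Qed.

End overshoot_moments.

(** * Passing a threshold, and the return to selection numbers *)

Section eventually_large.
Context {R : realType} (mu : probability R R).
Hypothesis tail_gt0 : forall a, 0 < tail mu a.

Lemma rec_chain_count_nbhs psi (x : nat -> R) :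
  (forall k, exists n, (k <= (rec_chain psi x n).1.1)%N) ->
  forall k, \forall n \near \oo, (k <= (rec_chain psi x n).1.1)%N.
Proof.
move=> coo k; have [n kn] := coo k; exists n => // m nm.
exact: leq_trans kn (rec_chain_count_nd psi x _ _ nm).
Qed.

Lemma rec_chain_avg_nd psi (x : nat -> R) m n : (m <= n)%N ->
  (rec_chain psi x m).1.2 <= (rec_chain psi x n).1.2.
Proof.
move=> /subnK <-; elim: (n - m)%N => // k IHk; apply: le_trans IHk _.
rewrite addSn /rec_chain /= /rec_step /=; case: ifP => //= ax.
by rewrite lerDl divr_ge0// subr_ge0 ltW.
Qed.

(* While the average stays below a1 it gains at least 1/(k+1) whenever the
   selected value exceeds a1 + 1, so its increments dominate those of the
   convergent martingale plus a multiple of the harmonic series. *)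
Lemma rec_chain_avg_ge a1 (x : nat -> R) :
  let v := rec_chain (jump_score mu a1) x in
  (forall k, exists n, (k <= (v n).1.1)%N) -> cvgn (fun n => (v n).2) ->
  \forall n \near \oo, a1 <= (v n).1.2.
Proof.
move=> v coo /cvg_ex[/= l /cvgrPdist_lt/(_ _ ltr01)[n1 _ Nl]].
have [[n an]|small] := pselect (exists n, a1 <= (v n).1.2).
  by exists n => // m nm; apply: le_trans an _; exact: rec_chain_avg_nd.
have {}small n : (v n).1.2 < a1.
  by rewrite ltNge; apply/negP => an; apply: small; exists n.
exfalso.
pose p := tail mu (a1 + 1).
pose harm (k : nat) : R := \sum_(i < k) i.+1%:R^-1.
(* If [Q] stays above its initial value, the average dominates [p] times the divergent harmonic
   series up to bounded terms, which is impossible below [a1]. *)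
pose Q n := (v n).1.2 - (v n).2 - p * harm (v n).1.1.
have Q_nd n : Q 0%N <= Q n.
  elim: n => // n IHn; apply: le_trans IHn _; rewrite /Q /v.
  rewrite {4 5 6}/rec_chain /= -/(rec_chain _ x n) -/v /rec_step /=.
  case: ifP => //= ax; rewrite {2}/harm big_ord_recr /= -/(harm _).
  rewrite /jump_score small ax /=.
  have k1 : 0 <= (v n).1.1.+1%:R^-1 :> R by rewrite invr_ge0.
  have q : p <= p / tail mu (v n).1.2.
    by rewrite ler_pdivlMr// ler_piMr ?tail_le1// (ltW (tail_gt0 _)).
  (* A value beyond [a1 + 1] exceeds an average below [a1] by more than 1. *)
  have ab : above (a1 + 1) (x n.+1) <= x n.+1 - (v n).1.2.
    rewrite /above; case: ltP => /= ?; have := small n; last by move: ax; lra.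
    lra.
  rewrite -/p; set c := (_.+1%:R)^-1 in k1 *.
  have : 0 <= (x n.+1 - (v n).1.2 -
      (above (a1 + 1) (x n.+1) - p / tail mu (v n).1.2) - p) * c.
    by rewrite mulr_ge0//; lra.
  clearbody c; lra.
have p0 : 0 < p by exact: tail_gt0.
have [k _ kln] := near_ln_gt ((a1 - Q 0%N - l + 1) / p).
have [n2 kn2] := coo k.
pose n := (n1 + n2)%N.
have Kn : (k <= (v n).1.1)%N.
  by apply: leq_trans kn2 _; apply: rec_chain_count_nd; exact: leq_addl.
have harm_gt : (a1 - Q 0%N - l + 1) / p < harm (v n).1.1.
  apply: lt_le_trans (ln_le_harmonic _).
  by apply: kln; exact: leqW.
have := Nl n (leq_addr _ _); rewrite /= ltr_norml => /andP[_ Nn].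
move: harm_gt; rewrite ltr_pdivrMr// mulrC => pharm.
by have := Q_nd n; have := small n; rewrite {2}/Q; lra.
Qed.

End eventually_large.

Section sel_mean_limit.
Context {R : realType}.

(** Every large [k] is the count at some late real time, so a limit in real time is also the limit
    along selection numbers. *)
Lemma sel_mean_cvg psi (x g : nat -> R) (l : R) :
  (forall k, exists n, (k <= (rec_chain psi x n).1.1)%N) ->
  (rec_chain psi x n).1.2 - g (rec_chain psi x n).1.1 @[n --> \oo] --> l ->
  sel_mean 1 x k - g k @[k --> \oo] --> l.
Proof.
move=> coo /cvgrPdist_lt al; apply/cvgrPdist_lt => e /al[n0 _ n0l].
exists (rec_chain psi x n0).1.1.+1 => // k /= n0k.
have [n n0n <-] := rec_chain_count_hits psi x n0 k coo n0k.
by rewrite sel_mean_rec_chain; exact: n0l.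
Qed.

(** At a selection from an average [a >= a1], [(x - a) / (k + 1)] splits into the drift
    [mrl mu a / (k + 1)] and the increment of the [score] martingale, as [coupled_cvg] expects. *)
Lemma rec_chain_coupled (mu : probability R R) (x g : nat -> R) (a1 : R) :
  let v := rec_chain (score mu a1) x in
  (forall u w, a1 <= u -> u <= w -> mrl mu w <= mrl mu u) ->
  (forall u, 0 < mrl mu u) ->
  (forall k, exists n, (k <= (v n).1.1)%N) ->
  cvgn (fun n => (v n).2) ->
  (\forall n \near \oo, a1 <= (v n).1.2) ->
  (\forall k \near \oo, a1 <= g k) ->
  cvgn (fun k => g k - \sum_(i < k) mrl mu (g i) / i.+1%:R) ->
  cvgn (fun n => (v n).1.2 - g (v n).1.1).
Proof.
move=> v f_ninc f_gt0 coo Ncvg a_ge g_ge gcvg.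
apply: (coupled_cvg (mrl mu) a1 (mrl mu a1) (fun n => (v n).1.2)
  (fun n => (v n).2) (fun n => (v n).1.1)) => //.
- by move=> u a1u; rewrite ltW//= f_ninc.
- move=> n; rewrite /v {1 3 5 6 9 10}/rec_chain /=.
  rewrite -/(rec_chain _ x n) -/v /rec_step /=.
  case: ifP => /= ax; last by left.
  right; split=> // an; rewrite /score an ax /=; ring.
- exact: rec_chain_count_nbhs.
Qed.

End sel_mean_limit.
Theorem theorem3p2 (R : realType) (d : measure_display) (T : measurableType d)
    (P : probability T R) (X : nat -> {RV P >-> R}) (F : R -> R) (x0 r : R)
    (X_iid : iid_with_df X F)
    (F_ac : distribution P (X 0%N) `<< @lebesgue_measure R)
    (F_lt1 : forall x, 0 < 1 - F x)
    (F_vm : von_mises F x0 r)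
    (hA : exists gamma a0 : R, 0 < gamma /\
      forall a, a0 < a -> (overshoot_moment (X 0%N) 2 a < (a `^ gamma)%:E)%E)
    (hB : exists a0 : R, forall a, a0 <= a ->
      derivable (mean_overshoot (X 0%N)) a 1 /\
      ((mean_overshoot (X 0%N))^`()%classic) a <= 0) :
  exists L : {RV P >-> R},
    {ae P, forall w,
      sel_mean 1 (fun i => X i w) k - G_inv (mean_overshoot (X 0%N)) x0 r (ln k%:R)
        @[k --> \oo] --> L w}.
Proof.
have [X_indep X_cdf] := X_iid.
pose mu : probability R R := distribution P (X 0%N).
have Xmu n B : measurable B -> P (X n @^-1` B) = mu B.
  by apply: eq_law_cdf => x; rewrite !X_cdf.
have muNy b : (mu `]-oo, b]%classic = (F b)%:E)%E by rewrite -(X_cdf 0%N).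
have tail_gt0 a : 0 < tail mu a.
  rewrite /tail -[mu _]/(ccdf (X 0%N) a) ccdf_1_cdf X_cdf.
  exact: F_lt1.
have fin2 : exists b, (\int[mu]_x (pos_part b x ^+ 2)%:E < +oo)%E.
  have [gamma [a0 [_ moment2]]] := hA; exists (a0 + 1).
  apply: excess2_fin_of_moment => //.
  by apply: lt_trans (moment2 _ _) _; rewrite ?ltry// ltrDl.
have meanE : mean_overshoot (X 0%N) = mrl mu by exact: mean_overshootE.
rewrite meanE in hB *.
have mrl_pos := mrl_gt0 mu tail_gt0 fin2.
have [a0 mrl_deriv] := hB.
(* From [a1] on the mean overshoot is nonincreasing, and [a1] lies inside the domain of [G]. *)
pose a1 := Num.max a0 (x0 + 1).
have x0a1 : x0 < a1 by rewrite lt_max ltrDl ltr01 orbT.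
have mrl_ninc u v : a1 <= u -> u <= v -> mrl mu v <= mrl mu u.
  rewrite ge_max => /andP[a0u _] uv.
  apply: (@ler0_derive1_nincry _ (mrl mu) a0) => //.
  - by move=> x; rewrite in_itv /= andbT => /ltW/mrl_deriv[].
  - by move=> x; rewrite in_itv /= andbT => /ltW/mrl_deriv[].
  - apply: derivable_within_continuous => x.
    by rewrite in_itv /= andbT => /mrl_deriv[].
have mrl_bnd a : a1 <= a -> mrl mu a <= mrl mu a1 by exact: mrl_ninc.
have excess2C := excess2_le mu tail_gt0 fin2 a1 _ (mrl_pos a1) mrl_bnd.
set C := 2 * _ in excess2C.
have C0 : 0 <= C by rewrite mulr_ge0// mulr_ge0// sqr_ge0.
pose g k := G_inv (mrl mu) x0 r (ln k%:R).
have r_gt0 : 0 < r by case: F_vm.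
have mfV : measurable_fun setT (fun u => (mrl mu u)^-1).
  have -> : (fun u => (mrl mu u)^-1) = (fun u => tail mu u * (excess mu u)^-1).
    by apply/funext => u; rewrite /mrl invf_div.
  apply: measurable_funM; first exact: measurable_tail.
  apply: nondecreasing_measurable => // u v uv.
  by rewrite lef_pV2 ?posrE ?excess_gt0// excess_ninc.
have fV_bnd y : exists M, forall u, u <= y -> (mrl mu u)^-1 <= M.
  (* [1 / mrl] is [tail / excess], where [tail] is at most 1 and [excess] is nonincreasing. *)
  exists (excess mu y)^-1 => u uy; rewrite lef_pV2 ?posrE ?excess_gt0//.
  apply: (le_trans (excess_ninc mu fin2 _ _ uy)).
  by rewrite ler_pdivlMr// ler_piMr ?tail_le1// excess_ge0.
have G_nd := G_fun_nd (mrl mu) x0 r r_gt0 mrl_pos mfV fV_bnd.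
have G_bnd :=
  G_fun_incr_bnd (mrl mu) x0 r a1 r_gt0 x0a1 mrl_pos mfV fV_bnd mrl_ninc.
have g_ge : \forall k \near \oo, a1 <= g k.
  exact: (near_pinv_ge (mrl mu) _ x0 a1 x0a1 mrl_pos mrl_ninc G_nd G_bnd).
have g_cvg : cvgn (fun k => g k - \sum_(i < k) mrl mu (g i) / i.+1%:R).
  exact: (cvg_pinv_sum (mrl mu) _ x0 a1 (mrl mu a1) x0a1 mrl_pos mrl_ninc
    G_nd G_bnd mrl_bnd).
have ae_count psi : {ae P, forall w k, exists n,
    (k <= (rec_chain psi (fun i => X i w) n).1.1)%N}.
  apply: filterS (ae_exceed P X mu X_indep Xmu _) => [w|b]; last first.
    by rewrite muNy lte_fin -subr_gt0.
  exact: rec_chain_count_unbounded.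
have ae_score := ae_rec_chain_cvg P X mu X_indep Xmu (score mu a1) C C0
  (measurable_score mu tail_gt0 fin2 a1) (score_supp mu a1)
  (integrable_score mu fin2 a1) (score_mean mu tail_gt0 fin2 a1)
  (integrable_score2 mu fin2 a1) (score_var mu tail_gt0 fin2 a1 C C0 excess2C)
  (ae_count _).
(* This second martingale brings the averages past [a1], where the first one becomes active. *)
have ae_jump := ae_rec_chain_cvg P X mu X_indep Xmu (jump_score mu a1) 1 ler01
  (measurable_jump_score mu tail_gt0 a1) (jump_score_supp mu a1)
  (integrable_jump_score mu a1) (jump_score_mean mu tail_gt0 a1)
  (integrable_jump_score2 mu tail_gt0 a1) (jump_score_var mu tail_gt0 a1)
  (ae_count _).
(* Zero weight: a measurable copy of the count and average common to all the chains. *)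
pose V := chainX P X rec_init (rec_step (fun _ _ => 0) (below 0 1)).
pose u n w := (V n w).1.2 - g (V n w).1.1.
have mV n : measurable_fun setT (V n).
  apply: measurable_chainX; first exact: measurable_rec_init.
  by apply: measurable_rec_step; exact: measurable_cst.
have measurable_u n : measurable_fun setT (u n).
  have m1 : measurable_fun setT (fun w => (V n w).1).
    exact: (measurableT_comp measurable_fst).
  apply: measurable_funB; first exact: (measurableT_comp measurable_snd).
  apply: (@measurableT_comp _ _ _ _ _ _ g) => //.
  exact: (measurableT_comp measurable_fst).
(* The limsup made real by [fine] is defined and measurable everywhere, and equals the limit
   wherever the sequence converges in [R]. *)
have mL : measurable_fun setT (fun w => fine (limn_esup (fun n => (u n w)%:E))).
  apply: measurableT_comp => //; apply: measurable_fun_limn_esup => n.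
  exact/measurable_EFinP.
exists (mfun_Sub (mem_set mL : _ \in mfun)).
apply: filterS3 (ae_count (score mu a1)) ae_score ae_jump => w count Ncvg Jcvg.
pose x i := X i w.
have E1 psi n : (rec_chain psi x n).1 = (V n w).1 by exact: chain_rec_step1.
have a_ge : \forall n \near \oo, a1 <= (rec_chain (score mu a1) x n).1.2.
  have : \forall n \near \oo, a1 <= (rec_chain (jump_score mu a1) x n).1.2.
    apply: rec_chain_avg_ge => // k; have [n kn] := count k; exists n.
    by rewrite E1 -(E1 (score mu a1)).
  by apply: filterS => n; rewrite !E1.
have /cvg_ex[/= l ul] : cvgn (u ^~ w).
  rewrite (_ : u ^~ w = fun n => (rec_chain (score mu a1) x n).1.2 -
      g (rec_chain (score mu a1) x n).1.1).
    exact: rec_chain_coupled.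
  by apply/funext => n; rewrite /u -(E1 (score mu a1)).
have -> : fine (limn_esup (fun n => (u n w)%:E)) = l.
  have ulE : (u n w)%:E @[n --> \oo] --> l%:E .
    by apply/fine_cvgP; split; [exact: nearW|exact: ul].
  rewrite is_cvg_limn_esupE; last by apply/cvg_ex; exists l%:E.
  by rewrite (cvg_lim _ ulE).
apply: (sel_mean_cvg (score mu a1)) => //.
rewrite (_ : (fun n => _) = u ^~ w)//.
by apply/funext => n; rewrite /u -(E1 (score mu a1)).
Qed.
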